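(* Let $X$ be a real-valued random variable with density $p$ satisfying the standing assumptions on $p$, $g$, $h$, $q$ listed in the context; in particular $p(x)=\exp(-(g(x)-q(x)))$ on $\mathbb{R}_+$ and $h=g'$ belongs to $\mathcal{R}$. Let $m(t)=\frac{d}{dt}\log\Phi(t)$ and $s^2(t)=\frac{d^2}{dt^2}\log\Phi(t)$ with $s(t)>0$, and let $\mathcal{X}_t$ be a random variable with density $\pi_t$. Then, as $t\to\infty$, the family of random variables $$\frac{\mathcal{X}_t-m(t)}{s(t)}$$ converges in distribution to a standard normal distribution.
   Context: Setting. $X$ is a real-valued random variable with support $\mathbb{R}$ and density $p$. Its moment generating function $\Phi(t)=\mathbb{E}[\exp(tX)]$ is finite in a non-void neighborhood of $0$; under the assumptions below it is finite for all large $t>0$. The tilted density (Esscher transform) with parameter $t$ is $\pi_t(x)=\frac{e^{tx}}{\Phi(t)}p(x)$, $x\in\mathbb{R}$. Form of the density. For $x\in\mathbb{R}_+$, $p(x)=\exp(-(g(x)-q(x)))$ (nothing else is assumed on the form of $p$ on the negative half-line). The function $g$ is positive, convex, four times differentiable and $g(x)/x\to\infty$ as $x\to\infty$. Put $h(x)=g'(x)$; $h$ is a positive monotone function on $\mathbb{R}_+$ and $h(x)\to\infty$ as $x\to\infty$. Let $\psi(t)=h^{\leftarrow}(t)$ be the inverse function of $h$ (considered for large $t$); $\psi(t)\to\infty$ as $t\to\infty$. $RV(\alpha)$ denotes the class of regularly varying functions (at infinity) of index $\alpha\in\mathbb{R}$ on $\mathbb{R}_+$, i.e. $f(\lambda x)/f(x)\to\lambda^\alpha$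 as $x\to\infty$ for every $\lambda>0$. The class $\mathcal{R}$: $h\in\mathcal{R}$ means that one of the following two cases holds. Case 1 (regularly varying case): $h(x)=x^\beta l(x)$ with $\beta>0$ and $l(x)=c\exp\int_1^x\frac{\epsilon(u)}{u}du$ for $x\ge 1$ and some $c>0$, where $\epsilon$ is twice differentiable and, as $x\to\infty$, $\epsilon(x)=o(1)$, $x|\epsilon'(x)|=O(1)$, $x^2|\epsilon^{(2)}(x)|=O(1)$. Moreover $|h^{(2)}(x)|\in RV(\theta)$ for a real number $\theta\le\beta-2$. Case 2 (rapidly varying case): $\psi\in RV(0)$ and $\psi(t)=c\exp\int_1^t\frac{\epsilon(u)}{u}du$ for $t\ge 1$ and some $c>0$, where $\epsilon$ is twice differentiable and, as $t\to\infty$, $\epsilon(t)=o(1)$, $\frac{t\epsilon'(t)}{\epsilon(t)}\to0$, $\frac{t^2\epsilon^{(2)}(t)}{\epsilon(t)}\to0$. In this case $h$ is called rapidly varying. Assumption on $q$: $q$ is bounded, and in Case 1, $|q(x)|\in RV(\eta)$ for some $\eta<\theta-\frac{3\beta}{2}-\frac32$; in Case 2, $|q(\psi(t))|\in RV(\eta)$ for some $\eta<-\frac12$. *)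

(* Defs.v *)
From HB Require Import structures.
From mathcomp Require Export all_boot all_order all_algebra.
From mathcomp Require Export all_classical all_reals all_analysis measurable_realfun.

Set Implicit Arguments.
Unset Strict Implicit.
Unset Printing Implicit Defensive.

Export Order.TTheory GRing.Theory Num.Theory.
Export numFieldNormedType.Exports.

Local Open Scope ring_scope.
Local Open Scope classical_set_scope.

(* The half-line R_+ is read as [0, +oo[, except that derivatives are only
   taken at x > 0, so that densities such as c * exp(- x^(3/2)) qualify. *)

(* Since MathComp's division by 0 is 0 and a `^ alpha > 0 for a > 0, this forces
   f x != 0 for all large x. *)
Definition regularly_varying (R : realType) (f : R -> R) (alpha : R) : Prop :=
  forall a : R, 0 < a -> f (a * x) / f x @[x --> +oo] --> a `^ alpha.

(* "eps is twice differentiable on [1, +oo[". A function with one-sided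
   derivatives at 1 extends quadratically below 1, so asking for two-sided
   derivatives at 1 of a function on the whole line loses nothing. *)
Definition twice_derivable_from1 (R : realType) (eps : R -> R) : Prop :=
  forall x : R, 1 <= x -> derivable eps x 1 /\ derivable eps^`() x 1.

Definition karamata (R : realType) (c : R) (eps : R -> R) (x : R) : R :=
  c * expR (\int[lebesgue_measure]_(u in `[1, x]) (eps u / u)).

Definition regularly_varying_case (R : realType) (h : R -> R)
    (beta theta : R) : Prop :=
  [/\ 0 < beta,
      exists (c : R) (eps : R -> R),
        [/\ 0 < c /\ twice_derivable_from1 eps,
            forall x : R, 1 <= x -> h x = x `^ beta * karamata c eps x,
            eps x @[x --> +oo] --> 0,
            bounded_near (fun x => x * `|eps^`() x|) +oo &
            bounded_near (fun x => x ^+ 2 * `|eps^`(2) x|) +oo],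
      theta <= beta - 2 &
      regularly_varying (fun x => `|h^`(2) x|) theta].

Definition rapidly_varying_case (R : realType) (psi : R -> R) : Prop :=
  regularly_varying psi 0 /\
  exists (c : R) (eps : R -> R),
    [/\ 0 < c /\ twice_derivable_from1 eps,
        forall t : R, 1 <= t -> psi t = karamata c eps t,
        eps t @[t --> +oo] --> 0,
        t * eps^`()%classic t / eps t @[t --> +oo] --> 0 &
        t ^+ 2 * eps^`(2)%classic t / eps t @[t --> +oo] --> 0].

(* psi is the inverse of h for large arguments; its values elsewhere are
   irrelevant to the asymptotics and left free. *)
Definition inverse_at_infty (R : realType) (h psi : R -> R) : Prop :=
  [/\ \forall t \near +oo, h (psi t) = t,
      \forall x \near +oo, psi (h x) = x &
      psi t @[t --> +oo] --> +oo].

Definition has_density (d : measure_display) (T : measurableType d)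
    (R : realType) (P : probability T R) (X : {RV P >-> R}) (p : R -> R) : Prop :=
  [/\ measurable_fun setT p,
      forall x, 0 <= p x &
      forall A : set R, measurable A ->
        distribution P X A = (\int[lebesgue_measure]_(x in A) (p x)%:E)%E].

(* The topological support of the law of X is the whole line. *)
Definition full_support (d : measure_display) (T : measurableType d)
    (R : realType) (P : probability T R) (X : {RV P >-> R}) : Prop :=
  forall U : set R, open U -> U !=set0 -> (0 < distribution P X U)%E.

Definition mgf (d : measure_display) (T : measurableType d)
    (R : realType) (P : probability T R) (X : {RV P >-> R}) (t : R) : R :=
  fine ('M_P X t).

Definition tilted_mean (d : measure_display) (T : measurableType d)
    (R : realType) (P : probability T R) (X : {RV P >-> R}) : R -> R :=
  (fun u => ln (mgf X u))^`()%classic.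

Definition tilted_sd (d : measure_display) (T : measurableType d)
    (R : realType) (P : probability T R) (X : {RV P >-> R}) (t : R) : R :=
  Num.sqrt ((fun u => ln (mgf X u))^`(2)%classic t).

Definition tilted_density (d : measure_display) (T : measurableType d)
    (R : realType) (P : probability T R) (X : {RV P >-> R}) (p : R -> R)
    (t x : R) : R :=
  expR (t * x) / mgf X t * p x.

Definition standardized (d : measure_display) (T : measurableType d)
    (R : realType) (P : probability T R) (Y : {RV P >-> R}) (m s : R) :
    {RV P >-> R} :=
  s^-1 \o* (Y \- cst m).

(* The variables Z i may live on different probability spaces. *)
Definition cvg_in_distribution (R : realType) (I : Type) (F : set_system I)
    (d : I -> measure_display) (T : forall i, measurableType (d i))
    (P : forall i, probability (T i) R) (Z : forall i, {RV (P i) >-> R})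
    (mu : probability (measurableTypeR R) R) : Prop :=
  forall x : R, {for x, continuous (fun y : R => mu `]-oo, y])} ->
    cdf (Z i) x @[i --> F] --> mu `]-oo, x].

(* Standing assumptions on p = exp (- (g - q)) on R_+, apart from those that
   distinguish the regularly varying and the rapidly varying case. *)
Record density_form (R : realType) (p g q : R -> R) : Prop := {
  density_formE : forall x : R, 0 <= x -> p x = expR (- (g x - q x));
  g_positive : forall x : R, 0 <= x -> 0 < g x;
  g_convex : convex_function (`[0, +oo[%classic : set R) g;
  g_derivable4 : forall (k : nat) (x : R),
    (k < 4)%N -> 0 < x -> derivable g^`(k) x 1;
  g_superlinear : g x / x @[x --> +oo] --> +oo;
  h_positive : forall x : R, 0 < x -> 0 < g^`() x;
  h_monotone : forall x y : R, 0 < x -> x <= y -> g^`() x <= g^`() y;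
  h_cvg : g^`() x @[x --> +oo] --> +oo;
  q_bounded : [bounded q x | x in `[0, +oo[%classic]
}.

(* Main.v *)
Require Import Defs.
From mathcomp Require Import ring lra.

Set Implicit Arguments.
Unset Strict Implicit.
Unset Printing Implicit Defensive.

Local Open Scope ring_scope.
Local Open Scope classical_set_scope.

(** Why the theorem is true. The tilted density is proportional to
    e^(t y - g y + q y) on the positive half-line. For large t the concave
    function t y - g y is maximal at x = psi t, the point where the slope h = g'
    equals t, and its second derivative there is - h' x. With S x = 1 / sqrt (h' x)
    and y = x + S x * u, Laplace's method predicts the standard normal density in
    the variable u. The content of the proof is that this prediction holds, with
    enough uniformity to control the first two moments as well.

    Regular and rapid variation of h are used through a single consequence,
    [steep_derivatives]: near infinity h' > 0, |h''| h <= C h'^2, and h' / h^2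
    tends to 0. It holds as soon as h' = h / k with k' bounded and h k tending to
    infinity, since then h'' h / h'^2 = 1 - k' ([steep_derivatives_quotient]). In
    the regularly varying case k x = x / (beta + eps x), in the rapidly varying
    case k x = x * eps (h x).

    This property yields everything about the exponent. The derivative of S is
    of the order of sqrt h' / h, hence tends to 0, so that h' is asymptotically
    constant within O(S x) of x and the exponent lost at x + S x * u tends to
    u^2 / 2 ([bregman_cvg]). Convexity of g upgrades this to a lower bound of the
    loss, linear in |u| and uniform in x ([bregman_ge]), which is the domination
    needed to pass to the limit under integrals of functions of quadratic growth.
    Finally x is at most a power of h x, whereas the peak value of the exponent
    is at least h x - g 1; thus the negative half-line, where p is arbitrary, has
    a vanishing share even in the second moment ([left_tail_cvg0]). The factor
    e^q disappears because a bounded function whose modulus varies regularly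
    with a negative index tends to 0 ([regularly_varying_cvg0]).

    Dominated convergence ([laplace_principle]) then gives the limits of the
    zeroth, first and second moments of the profile and of its truncation to a
    half-line. The mean and the variance of the tilted law are the first two
    derivatives of the logarithm of the moment generating function, and
    differentiation under the integral sign expresses them by these moments:
    m(t) = x + o(S x) and s(t) ~ S x. Hence standardising by m(t) and s(t) has the
    same effect in the limit as centring at x and dividing by S x, and the
    distribution functions converge ([standardized_cvg_normal]). *)

(** * Affine substitution *)

(** The image of Lebesgue measure under an affine map, rescaled by the slope,
    agrees with Lebesgue measure on half-open intervals, hence everywhere. The
    integrand only has to be measurable: no regularity of the density is
    available on the negative half-line. *)
Lemma ge0_integral_affine (R : realType) (a s : R) (f : R -> \bar R) :
    0 < s -> measurable_fun setT f -> (forall x, (0 <= f x)%E) ->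
  (\int[lebesgue_measure]_y f y =
   s%:E * \int[lebesgue_measure]_u f (a + s * u)%R)%E.
Proof.
move=> s0 mf f0.
pose phi : measurableTypeR R -> measurableTypeR R := fun u => a + s * u.
have mphi : measurable_fun setT phi.
  by apply: measurable_funD => //; exact: measurable_funM.
pose s' : {nonneg R} := NngNum (ltW s0).
pose push := pushforward (@lebesgue_measure R) phi :
  {measure set (measurableTypeR R) -> \bar R}.
pose nu := push mphi.
have nuE A : measurable A -> lebesgue_measure A = mscale s' nu A.
  apply: (@lebesgue_measure_unique _ (mscale s' nu)) => _ [[b c] _ <-].
  change (lebesgue_measure `]b, c]%classic =
    s%:E * lebesgue_measure (phi @^-1` `]b, c]%classic))%E.
  have -> : phi @^-1` `]b, c]%classic = `](b - a) / s, (c - a) / s]%classic.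
    apply/seteqP; split => u; rewrite /= !in_itv/= /phi.
      by rewrite ltr_pdivrMr// ler_pdivlMr// ltrBlDl lerBrDl (mulrC u).
    by rewrite ltr_pdivrMr// ler_pdivlMr// ltrBlDl lerBrDl (mulrC u).
  rewrite !lebesgue_measure_itv/= !lte_fin ltr_pM2r ?invr_gt0// ltrD2r.
  case: ifP => bc; last by rewrite mule0.
  by rewrite -EFinD -EFinM; congr EFin; field; rewrite gt_eqF.
transitivity (\int[mscale s' nu]_y f y)%E.
  by apply: eq_measure_integral => A mA _; exact: nuE.
rewrite ge0_integral_mscale//=; congr (_ * _)%E.
by rewrite ge0_integral_pushforward// => y _; exact: f0.
Qed.

(** * Integration against a law with a density *)

Section density.
Local Open Scope ereal_scope.
Context d (T : measurableType d) (R : realType).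
Variables (mu nu : {measure set T -> \bar R}) (w : T -> R).
Hypotheses (mw : measurable_fun setT w) (w_ge0 : forall x, (0 <= w x)%R)
  (nuE : forall A, measurable A -> nu A = \int[mu]_(x in A) (w x)%:E).

Import HBNNSimple.

(** Monotone approximation reduces the identity to indicator functions, for
    which it is the definition of a density. *)
Lemma ge0_integral_density (f : T -> \bar R) :
  measurable_fun setT f -> (forall x, 0 <= f x) ->
  \int[nu]_x f x = \int[mu]_x (f x * (w x)%:E).
Proof.
move=> mf f0; pose f_ := nnsfun_approx measurableT mf.
have f_f x : (f_ n x)%:E @[n --> \oo] --> f x.
  by apply: cvg_nnsfun_approx => // y _; exact: f0.
transitivity (limn (fun n => \int[nu]_x (f_ n x)%:E)).
  rewrite -monotone_convergence//.
  - by apply: eq_integral => y _; apply/esym/cvg_lim => //; exact: f_f.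
  - by move=> n; exact/measurable_EFinP/measurable_funP.
  - by move=> n y _; rewrite lee_fin.
  - by move=> y _ m n mn; rewrite lee_fin; exact/lefP/nd_nnsfun_approx.
transitivity (limn (fun n => \int[mu]_x ((f_ n x)%:E * (w x)%:E))); last first.
  rewrite -monotone_convergence//.
  - apply: eq_integral => y _; apply/cvg_lim => //.
    by apply: cvgeZr => //; exact: f_f.
  - move=> n; apply: emeasurable_funM; exact/measurable_EFinP.
  - by move=> n y _; rewrite mule_ge0// lee_fin.
  - move=> y _ m n mn; rewrite lee_wpmul2r// ?lee_fin//.
    exact/lefP/nd_nnsfun_approx.
congr (limn _); apply/funext => n.
transitivity (\sum_(k \in range (f_ n))
    \int[nu]_x (k * \1_(f_ n @^-1` [set k]) x)%:E).
  under eq_integral do rewrite fimfunE -fsumEFin//.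
  rewrite ge0_integral_fsum//.
  - by move=> y; exact/measurable_EFinP/measurable_funM.
  - by move=> y x _; rewrite nnfun_muleindic_ge0.
transitivity (\sum_(k \in range (f_ n))
    \int[mu]_x ((k * \1_(f_ n @^-1` [set k]) x)%:E * (w x)%:E)); last first.
  rewrite -ge0_integral_fsum//.
  - apply: eq_integral => x _.
    rewrite -ge0_mule_fsuml.
      by rewrite fsumEFin// -fimfunE.
    by move=> y; rewrite nnfun_muleindic_ge0.
  - move=> y; apply: emeasurable_funM; last exact/measurable_EFinP.
    by exact/measurable_EFinP/measurable_funM.
  - by move=> y x _; rewrite mule_ge0 ?lee_fin// -lee_fin nnfun_muleindic_ge0.
apply: eq_fsbigr => r _.
rewrite integralZl_indic_nnsfun// integral_indic// setIT.
have mr : measurable (f_ n @^-1` [set r]) by exact: measurable_sfunP.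
have [r0|r0] := ltP r 0%R.
  rewrite preimage_nnfun0// measure0 mule0 integral0_eq// => x _.
  by rewrite indicE in_set0 mulr0 mul0e.
under eq_integral do rewrite EFinM -muleA.
rewrite ge0_integralZl//=; first last.
- by move=> x _; rewrite mule_ge0 ?lee_fin.
- by apply: emeasurable_funM; exact/measurable_EFinP.
congr (_ * _)%E; rewrite nuE// integral_mkcond; apply: eq_integral => x _.
by rewrite epatch_indic muleC.
Qed.

End density.

(** * Exponential moments and their derivatives *)

(** By [is_derive_exp_moment] this is the k-th derivative at tau of the two-sided
    Laplace transform of w. *)
Definition exp_moment (R : realType) (w : R -> R) (k : nat) (tau : R) : R :=
  \int[lebesgue_measure]_y (y ^+ k * (expR (tau * y) * w y)).

Section exp_moment.
Variables (R : realType) (w : R -> R) (lo hi : R).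
Hypotheses (mw : measurable_fun setT w) (w_ge0 : forall y, 0 <= w y).

Let expw (tau y : R) : R := expR (tau * y) * w y.

Hypotheses (int_lo : lebesgue_measure.-integrable setT (EFin \o expw lo))
  (int_hi : lebesgue_measure.-integrable setT (EFin \o expw hi)).

(** An exponential of rate e absorbs the k-th power, and e is the distance left
    between tau and the ends of the interval of rates: on either side of 0 one of
    the two extreme exponentials dominates. *)
Lemma exprn_expR_le (k : nat) (e tau y : R) :
    0 < e -> lo <= tau - e -> tau + e <= hi ->
  `|y| ^+ k * expR (tau * y) <=
    k`!%:R / e ^+ k * (expR (lo * y) + expR (hi * y)).
Proof.
move=> e0 lot thi.
have yk : `|y| ^+ k <= k`!%:R / e ^+ k * expR (e * `|y|).
  rewrite mulrAC ler_pdivlMr ?exprn_gt0// -exprMn (mulrC `|y|).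
  rewrite -ler_pdivrMl ?ltr0n ?fact_gt0// [leLHS]mulrC.
  have ey0 : 0 <= e * `|y| by rewrite mulr_ge0// ltW.
  case: (k) => [|n]; first by rewrite expr0 divr1 -expR0 ler_expR.
  by rewrite (le_trans _ (expR_ge1Dxn n ey0))// lerDr.
apply: (le_trans (ler_wpM2r (expR_ge0 _) yk)).
rewrite -[leLHS]mulrA ler_wpM2l//; first by rewrite divr_ge0// exprn_ge0// ltW.
rewrite -expRD; have [y0|y0] := leP 0 y.
  rewrite (ger0_norm y0) (le_trans (y := expR (hi * y)))//.
    by rewrite ler_expR -mulrDl ler_wpM2r// addrC.
  by rewrite lerDr expR_ge0.
rewrite (ltr0_norm y0) (le_trans (y := expR (lo * y)))//.
  by rewrite ler_expR mulrN -mulNr -mulrDl (ler_wnM2r (ltW y0))// addrC.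
by rewrite lerDl expR_ge0.
Qed.

Let bound (k : nat) (e y : R) : R := k`!%:R / e ^+ k * (expw lo y + expw hi y).

Let bound_ge0 k e y : 0 < e -> 0 <= bound k e y.
Proof.
move=> e0; rewrite /bound mulr_ge0//.
  by rewrite divr_ge0// exprn_ge0// ltW.
by rewrite addr_ge0// /expw mulr_ge0// expR_ge0.
Qed.

Let integrable_bound k e :
  lebesgue_measure.-integrable setT (EFin \o bound k e).
Proof.
have := integrableZl measurableT (k`!%:R / e ^+ k)
  (integrableD measurableT int_lo int_hi).
by apply: eq_integrable => // y _; rewrite /= -EFinD -EFinM.
Qed.

Let le_bound k e tau y : 0 < e -> lo <= tau - e -> tau + e <= hi ->
  `|y ^+ k * expw tau y| <= bound k e y.
Proof.
move=> e0 lot thi; rewrite normrM normrX.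
rewrite (ger0_norm (mulr_ge0 (expR_ge0 (tau * y)) (w_ge0 y))).
rewrite /bound /expw -mulrDl !mulrA ler_wpM2r//.
exact: exprn_expR_le.
Qed.

Let measurable_expw tau : measurable_fun setT (expw tau).
Proof.
by apply: measurable_funM => //; apply: measurableT_comp.
Qed.

Let measurable_moment k tau : measurable_fun setT (fun y : R => y ^+ k * expw tau y).
Proof. by apply: measurable_funM => //; exact: measurable_funX. Qed.

Lemma exp_moment_integrable k tau : lo < tau < hi ->
  lebesgue_measure.-integrable setT
    (EFin \o (fun y => y ^+ k * (expR (tau * y) * w y))).
Proof.
move=> /andP[lot thi].
pose e := Num.min (tau - lo) (hi - tau).
have e0 : 0 < e by rewrite lt_min !subr_gt0 lot.
apply: (le_integrable measurableT _ _ (integrable_bound k e)).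
  by apply/measurable_EFinP; exact: measurable_moment.
move=> y _; rewrite /= lee_fin.
rewrite [leRHS]ger0_norm ?bound_ge0//; apply: le_bound => //.
  by rewrite lerBrDr -lerBrDl /e ge_min lexx.
by rewrite -lerBrDl /e ge_min lexx orbT.
Qed.

(** Differentiation under the integral sign. All the derivatives near tau are
    below one multiple of the two extreme exponentials, which are integrable
    against w. *)
Lemma is_derive_exp_moment k tau : lo < tau < hi ->
  is_derive tau 1 (exp_moment w k) (exp_moment w k.+1 tau).
Proof.
move=> /andP[lot thi].
(* Half of the room around tau is spent on letting the rate vary, the other half
   on absorbing the power of y. *)
pose e := Num.min (tau - lo) (hi - tau) / 2.
have e0 : 0 < e by rewrite divr_gt0// lt_min !subr_gt0 lot.
have elo : lo <= tau - e - e.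
  by rewrite -addrA -opprD -splitr lerBrDr -lerBrDl ge_min lexx.
have ehi : tau + e + e <= hi.
  by rewrite -addrA -splitr -lerBrDl /e ge_min lexx orbT.
have der (x y : R) : is_derive x 1 (fun z : R => y ^+ k * (expR (z * y) * w y))
    (y ^+ k.+1 * expw x y).
  have -> : (fun z : R => y ^+ k * (expR (z * y) * w y)) =
      (fun z : R => (y ^+ k * w y) *: expR (z * y)).
    by apply/funext => z; rewrite mulrCA mulrC.
  apply: is_derive_eq.
  rewrite /GRing.scale/= /expw exprSr; ring.
have der1 (x y : R) : partial1of2 (fun z y : R => y ^+ k * (expR (z * y) * w y)) x y =
    y ^+ k.+1 * expw x y.
  by rewrite partial1of2E; apply: derive_val; exact: der.
have I_bounds (x : R) : `]tau - e, tau + e[%classic x ->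
    lo < x < hi /\ (lo <= x - e /\ x + e <= hi).
  rewrite /= in_itv/= => /andP[tx xt]; split; first by apply/andP; split; lra.
  by split; lra.
have tauI : `]tau - e, tau + e[%classic tau by rewrite /= in_itv/=; lra.
have int_moment (x : R) : `]tau - e, tau + e[%classic x ->
    lebesgue_measure.-integrable setT
      (EFin \o (fun y : R => y ^+ k * (expR (x * y) * w y))).
  by move=> /I_bounds[? _]; exact: exp_moment_integrable.
have derivable_moment (x y : R) : `]tau - e, tau + e[%classic x -> setT y ->
    derivable (fun z : R => y ^+ k * (expR (z * y) * w y)) x 1.
  by move=> _ _; apply: ex_derive.
have ub (x y : R) : `]tau - e, tau + e[%classic x -> setT y ->
    `|partial1of2 (fun z y : R => y ^+ k * (expR (z * y) * w y)) x y|
      <= bound k.+1 e y.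
  by move=> /I_bounds[_ [? ?]] _; rewrite der1; exact: le_bound.
split.
  apply: (derivable_under_integral measurableT tauI int_moment
    derivable_moment (fun y : R => bound_ge0 k.+1 y e0) (integrable_bound _ _) ub).
rewrite -derive1E.
rewrite (differentiation_under_integral measurableT tauI int_moment
    derivable_moment (fun y : R => bound_ge0 k.+1 y e0) (integrable_bound _ _) ub).
by rewrite /exp_moment; apply: eq_Rintegral => y _; rewrite der1.
Qed.

End exp_moment.

(** * Moments of the standard normal law *)

Section normal_moments.
Variable R : realType.
Implicit Type tau : R.

Lemma expR_normal_pdf tau (u : R) :
  expR (tau * u) * normal_pdf 0 1 u = expR (tau ^+ 2 / 2) * normal_pdf tau 1 u.
Proof.
rewrite !normal_pdfE ?oner_neq0// /normal_fun !mulrA ![_ * normal_peak _]mulrC.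
rewrite -!mulrA -!expRD; congr (_ * expR _).
rewrite expr1n subr0 -mulr_natl mulr1; lra.
Qed.

Lemma integrable_expR_normal_pdf tau : lebesgue_measure.-integrable setT
  (EFin \o (fun u : R => expR (tau * u) * normal_pdf 0 1 u)).
Proof.
have := integrableZl measurableT (expR (tau ^+ 2 / 2))
  (integrable_normal_pdf tau 1).
by apply: eq_integrable => // u _; rewrite /= expR_normal_pdf EFinM.
Qed.

(** Completing the square turns the exponentially weighted density into the
    density of the law with mean tau, whose mass is 1. The higher moments follow
    by differentiating this closed form. *)
Lemma exp_moment_normal0 tau :
  exp_moment (normal_pdf 0 1) 0 tau = expR (tau ^+ 2 / 2).
Proof.
transitivity (\int[lebesgue_measure]_u
    (expR (tau ^+ 2 / 2) * normal_pdf tau 1 u)).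
  by apply: eq_Rintegral => u _; rewrite expr0 mul1r expR_normal_pdf.
rewrite RintegralZl//; last exact: integrable_normal_pdf.
by rewrite /Rintegral integral_normal_pdf mulr1.
Qed.

Lemma is_derive_exp_moment_normal k tau :
  is_derive tau 1 (exp_moment (normal_pdf 0 1) k)
    (exp_moment (normal_pdf 0 1) k.+1 tau).
Proof.
apply: (@is_derive_exp_moment _ _ (tau - 1) (tau + 1)).
- exact: measurable_normal_pdf.
- exact: normal_pdf_ge0.
- exact: integrable_expR_normal_pdf.
- exact: integrable_expR_normal_pdf.
- lra.
Qed.

Lemma exp_moment_normal1 tau :
  exp_moment (normal_pdf 0 1) 1 tau = tau * expR (tau ^+ 2 / 2).
Proof.
rewrite -(@derive_val _ _ _ _ _ _ _ (is_derive_exp_moment_normal 0 tau)).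
have -> : exp_moment (normal_pdf 0 1) 0 =
    expR \o (fun v : R => 2^-1 *: (v * v)) :> (R -> R).
  apply/funext => v; rewrite exp_moment_normal0 /= /GRing.scale/=.
  by rewrite expr2 mulrC.
by rewrite derive_val /GRing.scale/= expr2 [2^-1 * _]mulrC; field.
Qed.

Lemma exp_moment_normal2 : exp_moment (normal_pdf 0 1) 2 0 = 1 :> R.
Proof.
rewrite -(@derive_val _ _ _ _ _ _ _ (is_derive_exp_moment_normal 1 0)).
have -> : exp_moment (normal_pdf 0 1) 1 =
    (fun v : R => v * (expR \o (fun v : R => 2^-1 *: (v * v))) v) :> (R -> R).
  apply/funext => v; rewrite exp_moment_normal1 /= /GRing.scale/=.
  by rewrite expr2 [2^-1 * _]mulrC.
by rewrite derive_val /GRing.scale/= !mulr0 expR0; ring.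
Qed.

End normal_moments.

(** * A Laplace principle *)

Section laplace_dominating.
Variable R : realType.

Lemma integrable_expR_abs (l : R) : 0 < l ->
  lebesgue_measure.-integrable setT (EFin \o (fun u : R => expR (- (l * `|u|)))).
Proof.
move=> l0.
have cE : continuous (fun u : R => expR (- (l * `|u|))).
  move=> u; apply: continuous_comp; last exact: continuous_expR.
  apply: continuousN; apply: cvgMr; exact: norm_continuous.
apply/integrableP; split.
  by apply/measurable_EFinP; exact: continuous_measurable_fun.
under eq_integral do rewrite /= ger0_norm ?expR_ge0//.
rewrite (ge0_symfun_integralT (fun u : R => expR_ge0 (- (l * `|u|))) cE);
  last by move=> u /=; rewrite normrN.
rewrite integral_mkcond.
rewrite (_ : integral _ _ _ =
    \int[lebesgue_measure]_u (l^-1 * exponential_pdf l u)%:E)%E; last first.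
  apply: eq_integral => u _; rewrite patchE; case: ifPn => [|nu0].
    rewrite inE/= => u0; rewrite exponential_pdfE// ger0_norm// mulrA.
    by rewrite mulVf ?gt_eqF// mul1r mulNr.
  rewrite lt0_exponential_pdf ?mulr0// ltNge; apply: contra nu0.
  by move=> u0; rewrite inE.
under eq_integral do rewrite EFinM.
rewrite integralZl//; last exact: integrable_exponential_pdf.
by rewrite integral_exponential_pdf// mule1 ltry.
Qed.

End laplace_dominating.

(** The unnormalised tilted density e^(t y) p y in the variable u such that
    y = x + s u; the amplitude a stands for the factor that makes its peak value
    comparable with that of the normal density. *)
Definition tilted_profile (R : realType) (p : R -> R) (t x s a u : R) : R :=
  a * (expR (t * (x + s * u)) * p (x + s * u)).

Section profile.
Variables (R : realType) (p : R -> R).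
Hypotheses (mp : measurable_fun setT p) (p_ge0 : forall y, 0 <= p y).

Lemma measurable_tilted_profile t x s a :
  measurable_fun setT (tilted_profile p t x s a).
Proof.
have maff : measurable_fun setT (fun u : R => x + s * u).
  by apply: measurable_funD => //; exact: measurable_funM.
apply: measurable_funM => //; apply: measurable_funM.
  by apply: measurableT_comp => //; exact: measurable_funM.
exact: (measurableT_comp mp maff).
Qed.

Lemma tilted_profile_ge0 t x s a u : 0 <= a -> 0 <= tilted_profile p t x s a u.
Proof. by move=> a0; rewrite /tilted_profile !mulr_ge0// expR_ge0. Qed.

Lemma quadratic_expR_le (t x s y : R) : 1 <= t -> 0 < s -> y <= 0 ->
  (1 + ((y - x) / s) ^+ 2) * expR (t * y) <= 1 + (4 + 2 * x ^+ 2) / s ^+ 2.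
Proof.
move=> t1 s0 y0.
have ety : expR (t * y) <= 1 by rewrite expR_le1 mulr_ge0_le0// (le_trans _ t1).
have eyy : expR (t * y) <= expR y by rewrite ler_expR ler_neMl.
have y2 : y ^+ 2 * expR y <= 2.
  have Ny0 : 0 <= - y by rewrite oppr_ge0.
  have := expR_ge1Dxn 1 Ny0; rewrite expRN sqrrN (_ : 2`!%:R = 2)//.
  rewrite -[_ <= _^-1](ler_pM2r (expR_gt0 y)) mulVf ?gt_eqF ?expR_gt0//.
  have := expR_gt0 y; nra.
have {eyy} : y ^+ 2 * expR (t * y) <= 2.
  by rewrite (le_trans _ y2)// ler_wpM2l// sqr_ge0.
have := expR_gt0 (t * y); move: (expR (t * y)) ety => e e1 e0 ye.
rewrite expr_div_n mulrDl mul1r; apply: lerD => //.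
rewrite mulrAC ler_wpM2r ?invr_ge0 ?sqr_ge0//.
rewrite (le_trans (y := 2 * (y ^+ 2 * e) + 2 * x ^+ 2 * e))//.
  have : 0 <= (y + x) ^+ 2 * e by rewrite mulr_ge0 ?sqr_ge0// ltW.
  nra.
have : x ^+ 2 * e <= x ^+ 2 by rewrite ler_piMr ?sqr_ge0.
lra.
Qed.

(** The negative half-line, where nothing but measurability is known about p:
    both e^(t y) and y^2 e^(t y) are bounded there, so the integral costs no more
    than the total mass of p, which is at most 1. *)
Lemma integral_profile_left (t x s a : R) :
    (\int[lebesgue_measure]_y (p y)%:E <= 1)%E ->
    1 <= t -> 0 < s -> 0 <= a ->
  (\int[lebesgue_measure]_u ((1 + u ^+ 2) * tilted_profile p t x s a u *
      \1_(`]-oo, (- x / s)%R]%classic : set R) u)%:E <=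
    (a / s * (1 + (4 + 2 * x ^+ 2) / s ^+ 2))%:E)%E.
Proof.
move=> p1 t1 s0 a0.
pose f (y : R) : R := (1 + ((y - x) / s) ^+ 2) * (a * (expR (t * y) * p y)) *
  \1_(`]-oo, 0%R]%classic : set R) y.
have f0 y : (0 <= (f y)%:E)%E.
  by rewrite lee_fin /f !mulr_ge0 ?expR_ge0// addr_ge0// sqr_ge0.
have mf : measurable_fun setT (fun y => (f y)%:E).
  apply/measurable_EFinP; apply: measurable_funM; last exact: measurable_indic.
  apply: measurable_funM.
    apply: measurable_funD => //; apply: measurable_funX.
    by apply: measurable_funM => //; exact: measurable_funB.
  apply: measurable_funM => //; apply: measurable_funM => //.
  by apply: measurableT_comp => //; exact: measurable_funM.
have -> : (\int[lebesgue_measure]_u ((1 + u ^+ 2) * tilted_profile p t x s a u *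
      \1_(`]-oo, (- x / s)%R]%classic : set R) u)%:E =
    s^-1%:E * \int[lebesgue_measure]_y (f y)%:E)%E.
  rewrite (ge0_integral_affine x s0 mf f0) muleA -EFinM mulVf ?gt_eqF// mul1e.
  apply: eq_integral => u _; rewrite /f /tilted_profile.
  rewrite (_ : (x + s * u - x) / s = u); last by field; rewrite gt_eqF.
  congr (_ * _)%:E.
  rewrite !indicE; congr (_ : bool)%:R; apply/idP/idP; rewrite !inE/= !in_itv/=.
    by rewrite ler_pdivlMr// lerNr -lerBrDl sub0r mulrC => ?; lra.
  by rewrite ler_pdivlMr// mulrC => ?; lra.
have fp y : ((f y)%:E <= (a * (1 + (4 + 2 * x ^+ 2) / s ^+ 2))%:E * (p y)%:E)%E.
  rewrite -EFinM lee_fin /f indicE; have [y0|] := boolP (y \in _); last first.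
    move=> _; rewrite mulr0 !mulr_ge0// addr_ge0// divr_ge0 ?sqr_ge0//.
    by rewrite addr_ge0// mulr_ge0// sqr_ge0.
  move: y0; rewrite inE/= in_itv/= => y0; rewrite mulr1 mulrCA -mulrA ler_wpM2l//.
  by rewrite mulrA ler_wpM2r//; exact: quadratic_expR_le.
rewrite -(mulrC s^-1) -mulrA EFinM lee_wpmul2l ?lee_fin ?invr_ge0 ?(ltW s0)//.
apply: (@le_trans _ _ (\int[lebesgue_measure]_y
    ((a * (1 + (4 + 2 * x ^+ 2) / s ^+ 2))%:E * (p y)%:E))%E).
  apply: ge0_le_integral => //.
  by apply: emeasurable_funM => //; exact/measurable_EFinP.
have c0 : 0 <= a * (1 + (4 + 2 * x ^+ 2) / s ^+ 2).
  rewrite mulr_ge0// addr_ge0// divr_ge0 ?sqr_ge0//.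
  by rewrite addr_ge0// mulr_ge0// sqr_ge0.
rewrite ge0_integralZl//; last 2 first.
  - exact/measurable_EFinP.
  - by move=> y _; rewrite lee_fin.
by rewrite -[leRHS]mule1 lee_wpmul2l// lee_fin.
Qed.

End profile.

Section laplace.
Variables (R : realType) (p : R -> R) (x s a : R -> R) (C : R).
Hypotheses (mp : measurable_fun setT p) (p_ge0 : forall y, 0 <= p y)
  (p1 : (\int[lebesgue_measure]_y (p y)%:E <= 1)%E)
  (a_ge0 : forall t, 0 <= a t) (C_ge0 : 0 <= C)
  (s_gt0 : \forall t \near +oo, 0 < s t)
  (right_gt0 : forall u, \forall t \near +oo, 0 < x t + s t * u)
  (profile_cvg : forall u,
    tilted_profile p t (x t) (s t) (a t) u @[t --> +oo] --> normal_pdf 0 1 u)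
  (profile_le : \forall t \near +oo, forall u, 0 < x t + s t * u ->
    tilted_profile p t (x t) (s t) (a t) u <= C * expR (- (4^-1 * `|u|)))
  (left_cvg0 :
    a t / s t * (1 + (4 + 2 * x t ^+ 2) / s t ^+ 2) @[t --> +oo] --> 0).

Let prof t u := tilted_profile p t (x t) (s t) (a t) u.
Let rght t : set R := `](- x t / s t)%R, +oo[%classic.
Let lft t : set R := `]-oo, (- x t / s t)%R]%classic.

Let mprof t : measurable_fun setT (prof t).
Proof. exact: measurable_tilted_profile. Qed.

Let prof_ge0 t u : 0 <= prof t u.
Proof. exact: tilted_profile_ge0. Qed.

Let indic_rl t (u : R) : \1_(rght t) u + \1_(lft t) u = 1 :> R.
Proof.
rewrite !indicE /rght /lft; have [h|h] := ltP (- x t / s t) u.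
  rewrite mem_set/= ?in_itv/= ?h// memNset ?addr0//=.
  by rewrite in_itv/= => /(lt_le_trans h); rewrite ltxx.
rewrite memNset/= ?in_itv/= ?andbT.
  by rewrite mem_set ?add0r//= in_itv/=.
by move=> /(le_lt_trans h); rewrite ltxx.
Qed.

Let m_rght t : measurable_fun setT (\1_(rght t) : R -> R).
Proof. by apply: measurable_indic; exact: measurable_itv. Qed.

Let m_lft t : measurable_fun setT (\1_(lft t) : R -> R).
Proof. by apply: measurable_indic; exact: measurable_itv. Qed.

(* Half of the exponential decay rate 1 / 4 is given up to absorb 1 + u ^ 2. *)
Let bound (u : R) : R := 128 * C * expR (- (8^-1 * `|u|)).

Let integrable_bound : lebesgue_measure.-integrable setT (EFin \o bound).
Proof.
have h8 : 0 < 8^-1 :> R by rewrite invr_gt0.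
have := integrableZl measurableT (128 * C) (integrable_expR_abs h8).
by apply: eq_integrable => // u _; rewrite /= -EFinM.
Qed.

Lemma quadratic_le_expR (u : R) : 1 + u ^+ 2 <= 128 * expR (8^-1 * `|u|).
Proof.
have u8 : 0 <= 8^-1 * `|u| by rewrite mulr_ge0// invr_ge0.
have := expR_ge1Dxn 1 u8; rewrite exprMn real_normK ?num_real// (_ : 2`!%:R = 2)//.
lra.
Qed.

Let right_le : \forall t \near +oo, forall u,
  (1 + u ^+ 2) * prof t u * \1_(rght t) u <= bound u.
Proof.
near=> t => u; rewrite indicE.
have b0 : 0 <= bound u by rewrite /bound !mulr_ge0// expR_ge0.
have [ur|_] := boolP (u \in rght t); last by rewrite mulr0.
rewrite mulr1; move: ur; rewrite inE /rght/= in_itv/= andbT => ur.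
have st0 : 0 < s t by near: t.
have xu : 0 < x t + s t * u.
  by move: ur; rewrite ltr_pdivrMr// mulrC => ur; lra.
have pu : prof t u <= C * expR (- (4^-1 * `|u|)).
  by move: u xu {ur b0}; near: t.
have q0 : 0 <= 1 + u ^+ 2 by rewrite addr_ge0// sqr_ge0.
apply: (le_trans (ler_wpM2l q0 pu)).
rewrite /bound mulrCA [128 * C]mulrC -mulrA ler_wpM2l//.
apply: (le_trans (ler_wpM2r (expR_ge0 _) (quadratic_le_expR u))).
rewrite -mulrA ler_wpM2l// -expRD ler_expR; lra.
Unshelve. all: by end_near. Qed.

Let left_le : \forall t \near +oo,
  (\int[lebesgue_measure]_u ((1 + u ^+ 2) * prof t u * \1_(lft t) u)%:E <=
    (a t / s t * (1 + (4 + 2 * x t ^+ 2) / s t ^+ 2))%:E)%E.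
Proof.
near=> t; apply: integral_profile_left => //.
by near: t.
Unshelve. all: by end_near. Qed.

Let mquad : measurable_fun setT (fun u : R => 1 + u ^+ 2).
Proof. by apply: measurable_funD => //; exact: measurable_funX. Qed.

Let quad_ge0 (u : R) : 0 <= 1 + u ^+ 2.
Proof. by rewrite addr_ge0// sqr_ge0. Qed.

Let integrable_right : \forall t \near +oo, lebesgue_measure.-integrable setT
  (EFin \o (fun u => (1 + u ^+ 2) * prof t u * \1_(rght t) u)).
Proof.
near=> t; apply: (le_integrable measurableT _ _ integrable_bound).
  apply/measurable_EFinP; apply: measurable_funM; last exact: m_rght.
  by apply: measurable_funM => //; exact: mprof.
move=> u _; rewrite /= lee_fin ger0_norm; last by rewrite !mulr_ge0.
rewrite ger0_norm; first by move: u; near: t.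
by rewrite /bound !mulr_ge0// expR_ge0.
Unshelve. all: by end_near. Qed.

Let integrable_left : \forall t \near +oo, lebesgue_measure.-integrable setT
  (EFin \o (fun u => (1 + u ^+ 2) * prof t u * \1_(lft t) u)).
Proof.
near=> t; apply/integrableP; split.
  apply/measurable_EFinP; apply: measurable_funM; last exact: m_lft.
  by apply: measurable_funM => //; exact: mprof.
under eq_integral => u _ do rewrite /= ger0_norm ?mulr_ge0//.
have : (\int[lebesgue_measure]_u ((1 + u ^+ 2) * prof t u * \1_(lft t) u)%:E <=
    (a t / s t * (1 + (4 + 2 * x t ^+ 2) / s t ^+ 2))%:E)%E by near: t.
by move=> /le_lt_trans; apply; rewrite ltry.
Unshelve. all: by end_near. Qed.

Lemma laplace_integrable : \forall t \near +oo, forall (f : R -> R) D,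
  measurable_fun setT f -> (forall u, `|f u| <= D * (1 + u ^+ 2)) ->
  lebesgue_measure.-integrable setT
    (EFin \o (fun u => f u * tilted_profile p t (x t) (s t) (a t) u)).
Proof.
near=> t => f D mf fD.
have ir : lebesgue_measure.-integrable setT
    (EFin \o (fun u => (1 + u ^+ 2) * prof t u * \1_(rght t) u)) by near: t.
have il : lebesgue_measure.-integrable setT
    (EFin \o (fun u => (1 + u ^+ 2) * prof t u * \1_(lft t) u)) by near: t.
have := integrableZl measurableT D (integrableD measurableT ir il).
apply: le_integrable => //.
  by apply/measurable_EFinP; apply: measurable_funM => //; exact: mprof.
move=> u _; rewrite /= lee_fin -mulrDr indic_rl mulr1.
have pge0 : 0 <= tilted_profile p t (x t) (s t) (a t) u := prof_ge0 t u.
rewrite (normrM (f u)) (normrM D) (normrM (1 + u ^+ 2)) (ger0_norm pge0).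
rewrite (ger0_norm (quad_ge0 u)) mulrA ler_wpM2r// (le_trans (fD u))//.
by rewrite ler_wpM2r// ler_norm.
Unshelve. all: by end_near. Qed.

(** Laplace's method: to the right of the origin the profiles converge under a
    fixed exponential bound, so dominated convergence applies; to the left the
    whole integral vanishes in the limit. Quadratic growth of the test functions
    is what the variance requires, and the point z where convergence may fail
    accommodates the jump of an indicator function. *)
Theorem laplace_principle (f : R -> R -> R) (g : R -> R) (D z : R) :
    0 <= D -> (\forall t \near +oo, measurable_fun setT (f t)) ->
    (\forall t \near +oo, forall u, `|f t u| <= D * (1 + u ^+ 2)) ->
    measurable_fun setT g ->
    (forall u, u != z -> f t u @[t --> +oo] --> g u) ->
  (\int[lebesgue_measure]_u (f t u * tilted_profile p t (x t) (s t) (a t) u))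
    @[t --> +oo] --> \int[lebesgue_measure]_u (g u * normal_pdf 0 1 u).
Proof.
move=> D0 mf fD mg fg.
have split_int : \forall t \near +oo,
    \int[lebesgue_measure]_u (f t u * prof t u * \1_(rght t) u) +
    \int[lebesgue_measure]_u (f t u * prof t u * \1_(lft t) u) =
    \int[lebesgue_measure]_u (f t u * prof t u).
  near=> t.
  have mft : measurable_fun setT (f t) by near: t.
  have fDt : forall u, `|f t u| <= D * (1 + u ^+ 2) by near: t.
  have fp : lebesgue_measure.-integrable setT
      (EFin \o (fun u => f t u * prof t u)).
    move: (mft) (fDt); move: (f t) (D); near: t; exact: laplace_integrable.
  have part (A : set R) : measurable A -> lebesgue_measure.-integrable setT
      (EFin \o (fun u => f t u * prof t u * \1_A u)).
    move=> mA; apply: (le_integrable measurableT _ _ fp).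
      apply/measurable_EFinP; apply: measurable_funM.
        by apply: measurable_funM => //; exact: mprof.
      exact: measurable_indic.
    move=> u _; rewrite /= lee_fin normrM ler_piMr// indicE.
    by case: (u \in A); rewrite ?normr1 ?normr0.
  rewrite -RintegralD//; last 2 first.
  - by apply: part; exact: measurable_itv.
  - by apply: part; exact: measurable_itv.
  by apply: eq_Rintegral => u _; rewrite -mulrDr indic_rl mulr1.
rewrite -[X in _ --> X]addr0.
apply: (cvg_trans (near_eq_cvg split_int)); apply: cvgD; last first.
  apply/norm_cvg0P; apply: (@squeeze_cvgr _ _ _ _ (cst 0) (fun t =>
    D * (a t / s t * (1 + (4 + 2 * x t ^+ 2) / s t ^+ 2)))); last 2 first.
  - exact: cvg_cst.
  - by rewrite -[X in _ --> X](mulr0 D); apply: cvgM => //; exact: cvg_cst.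
  near=> t; rewrite /= normr_ge0/=.
  have mft : measurable_fun setT (f t) by near: t.
  have fDt : forall u, `|f t u| <= D * (1 + u ^+ 2) by near: t.
  have il : lebesgue_measure.-integrable setT
    (EFin \o (fun u => (1 + u ^+ 2) * prof t u * \1_(lft t) u)) by near: t.
  have ll : (\int[lebesgue_measure]_u
      ((1 + u ^+ 2) * prof t u * \1_(lft t) u)%:E <=
      (a t / s t * (1 + (4 + 2 * x t ^+ 2) / s t ^+ 2))%:E)%E by near: t.
  have iDl := integrableZl measurableT D il.
  have le_f u : `|f t u * prof t u * \1_(lft t) u| <=
      D * ((1 + u ^+ 2) * prof t u * \1_(lft t) u).
    have i0 : 0 <= \1_(lft t) u :> R by rewrite indicE.
    rewrite normrM (normrM (f t u)) (ger0_norm (prof_ge0 t u)) (ger0_norm i0).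
    rewrite !mulrA.
    by rewrite !ler_wpM2r// fDt.
  have i_f : lebesgue_measure.-integrable setT
      (EFin \o (fun u => f t u * prof t u * \1_(lft t) u)).
    apply: (le_integrable measurableT _ _ iDl).
      apply/measurable_EFinP; apply: measurable_funM; last exact: m_lft.
      by apply: measurable_funM => //; exact: mprof.
    move=> u _; rewrite /= lee_fin (le_trans (le_f u))//.
    by rewrite ler_norm.
  apply: (le_trans (le_normr_Rintegral measurableT i_f)).
  apply: (@le_trans _ _ (\int[lebesgue_measure]_u
      (D * ((1 + u ^+ 2) * prof t u * \1_(lft t) u)))).
    apply: le_Rintegral => //.
    exact: integrable_norm i_f.
  rewrite RintegralZl// ler_wpM2l// -lee_fin /Rintegral fineK//.
  exact: integrable_fin_num.
apply/cvg_pinftyP => v vy.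
have conds : \forall n \near \oo, measurable_fun setT (f (v n)) /\
    (forall u, `|f (v n) u| <= D * (1 + u ^+ 2)) /\
    (forall u, (1 + u ^+ 2) * prof (v n) u * \1_(rght (v n)) u <= bound u).
  apply: (vy (fun t => measurable_fun setT (f t) /\
    (forall u, `|f t u| <= D * (1 + u ^+ 2)) /\
    (forall u, (1 + u ^+ 2) * prof t u * \1_(rght t) u <= bound u))).
  near=> t; split; first by near: t.
  by split; near: t.
have [N _ {}conds] := conds.
have vNy : v (n + N)%N @[n --> \oo] --> +oo by rewrite cvg_shiftn.
rewrite -(cvg_shiftn N).
have vN n : measurable_fun setT (f (v (n + N)%N)) /\
    (forall u, `|f (v (n + N)%N) u| <= D * (1 + u ^+ 2)) /\
    (forall u, (1 + u ^+ 2) * prof (v (n + N)%N) u * \1_(rght (v (n + N)%N)) u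
      <= bound u).
  by apply: conds => /=; exact: leq_addl.
pose F n (u : R) := f (v (n + N)%N) u * prof (v (n + N)%N) u *
  \1_(rght (v (n + N)%N)) u.
pose G (u : R) := g u * normal_pdf 0 1 u.
have mF n : measurable_fun setT (EFin \o F n).
  apply/measurable_EFinP; apply: measurable_funM; last exact: m_rght.
  by apply: measurable_funM; [have [] := vN n|exact: mprof].
have mG : measurable_fun setT (EFin \o G).
  by apply/measurable_EFinP; apply: measurable_funM => //; exact: measurable_normal_pdf.
have FG (u : R) : u != z -> F n u @[n --> \oo] --> G u.
  move=> uz; rewrite -[G u]mulr1; apply: cvgM; first apply: cvgM.
  - exact: (cvg_comp _ _ vNy (fg u uz)).
  - exact: (cvg_comp _ (prof ^~ u) vNy (@profile_cvg u)).
  - suff h : \1_(rght t) u @[t --> +oo] --> (1 : R) by exact: (cvg_comp _ _ vNy h).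
    apply: cvg_near_cst; near=> t; rewrite indicE mem_set// /rght/= in_itv/= andbT.
    have st0 : 0 < s t by near: t.
    have : 0 < x t + s t * u by near: t; exact: right_gt0.
    by rewrite ltr_pdivrMr// mulrC => ?; lra.
have aeFG : {ae lebesgue_measure, forall u : R, setT u ->
    (EFin \o F n) u @[n --> \oo] --> (EFin \o G) u}.
  exists [set z]; split => //; first exact: lebesgue_measure_set1.
  move=> u /= nu; apply: contrapT => uz; apply: nu => _.
  by apply: cvg_EFin; [exact: nearW|apply: FG; exact/eqP].
have Fb : {ae lebesgue_measure, forall (u : R) n, setT u ->
    (`|(EFin \o F n) u| <= (D * bound u)%:E)%E}.
  apply: aeW => u n _; have [_ [fDn bn]] := vN n.
  rewrite /= lee_fin /F.
  have i0 : 0 <= \1_(rght (v (n + N)%N)) u :> R by rewrite indicE.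
  rewrite normrM (normrM (f _ u)) (ger0_norm (prof_ge0 _ u)) (ger0_norm i0).
  apply: (@le_trans _ _ (D * ((1 + u ^+ 2) * prof (v (n + N)%N) u *
      \1_(rght (v (n + N)%N)) u))); last by rewrite ler_wpM2l.
  by rewrite !mulrA !ler_wpM2r// fDn.
have iDb : lebesgue_measure.-integrable setT (fun u => (D * bound u)%:E).
  by have := integrableZl measurableT D integrable_bound; apply: eq_integrable.
have [iG _ FGint] := @dominated_convergence _ _ _ lebesgue_measure setT
  measurableT (fun n => EFin \o F n) (EFin \o G) _ mF mG aeFG iDb Fb.
apply: fine_cvg; rewrite fineK//.
exact: integrable_fin_num.
Unshelve. all: by end_near. Qed.

End laplace.

(** * Second-order expansion around a point *)

(** One application of Rolle's theorem, to the remainder as a function of the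
    base point, with the quadratic coefficient chosen so that it vanishes at both
    ends. The bounds by min and max allow b on either side of a. *)
Lemma taylor_order2 (R : realType) (f f1 f2 : R -> R) (a b : R) :
    (forall y, Num.min a b <= y <= Num.max a b -> is_derive y 1 f (f1 y)) ->
    (forall y, Num.min a b <= y <= Num.max a b -> is_derive y 1 f1 (f2 y)) ->
  exists2 c, Num.min a b <= c <= Num.max a b &
    f b = f a + f1 a * (b - a) + f2 c / 2 * (b - a) ^+ 2.
Proof.
move=> df df1; have [->|ab] := eqVneq a b.
  exists b; first by rewrite minxx maxxx lexx.
  by rewrite subrr mulr0 expr0n/= mulr0 !addr0.
have ba0 : b - a != 0 by rewrite subr_eq0 eq_sym.
pose M := (f b - f a - f1 a * (b - a)) / (b - a) ^+ 2.
pose phi y := f b - f y - f1 y * (b - y) - M * (b - y) ^+ 2.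
have phia : phi a = 0.
  by rewrite /phi /M; field.
have phib : phi b = 0 by rewrite /phi !subrr mulr0 expr0n/= mulr0 !subr0.
have dphi y : Num.min a b <= y <= Num.max a b ->
    is_derive y 1 phi ((b - y) * (2 * M - f2 y)).
  move=> yab; have dfy := df y yab; have df1y := df1 y yab.
  rewrite /phi; apply: is_derive_eq.
  rewrite /GRing.scale/=; ring.
have mM : Num.min a b < Num.max a b.
  by move: ab; have [] := ltgtP a b; rewrite ?eqxx.
have oc y : y \in `](Num.min a b), (Num.max a b)[%R ->
    Num.min a b <= y <= Num.max a b.
  by rewrite in_itv/= => /andP[/ltW-> /ltW->].
have cc y : y \in `[(Num.min a b), (Num.max a b)]%R ->
    Num.min a b <= y <= Num.max a b by rewrite in_itv.
have [c cab dc] : exists2 c, c \in `](Num.min a b), (Num.max a b)[%R &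
    is_derive c 1 phi 0.
  apply: (@Rolle _ phi _ _ mM).
  - by move=> y /oc /dphi ?; exact: ex_derive.
  - by apply: derivable_within_continuous => y /cc /dphi ?; exact: ex_derive.
  - by rewrite minEle maxEle; case: ifP; rewrite phia phib.
exists c; first exact: oc.
have : (b - c) * (2 * M - f2 c) = 0.
  have := dphi c (oc _ cab) => h.
  by rewrite -(@derive_val _ _ _ _ _ _ _ h) (@derive_val _ _ _ _ _ _ _ dc).
have bc0 : b - c != 0.
  rewrite subr_eq0; apply/eqP => bc; move: cab.
  rewrite in_itv/= -bc; case: (leP a b) => h; rewrite ltxx ?andbF//.
move=> /eqP; rewrite mulf_eq0 (negbTE bc0)/= subr_eq0 => /eqP <-.
by rewrite /M; field.
Qed.

(** * Self-neglecting functions *)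

Lemma mean_value_le (R : realType) (f f1 : R -> R) (e a b : R) :
    (forall y, Num.min a b <= y <= Num.max a b -> is_derive y 1 f (f1 y)) ->
    (forall y, Num.min a b <= y <= Num.max a b -> `|f1 y| <= e) ->
  `|f b - f a| <= e * `|b - a|.
Proof.
move=> df fe; wlog ab : a b df fe / a <= b.
  move=> H; have [ab|ba] := leP a b; first exact: H.
  rewrite distrC (distrC b); apply: H (ltW ba) => y;
    rewrite minC maxC; [exact: df|exact: fe].
rewrite (min_idPl ab) (max_idPr ab) in df fe.
have [||c cab ->] := @MVT_segment _ f f1 a b ab.
- by move=> y; rewrite in_itv/= => /andP[/ltW ay /ltW yb]; apply: df; rewrite ay.
- apply: derivable_within_continuous => y; rewrite in_itv/= => yab.
  by have := df y yab => ?; exact: ex_derive.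
by rewrite normrM ler_wpM2r// fe//; move: cab; rewrite in_itv.
Qed.

Section self_neglecting.
Variables (R : realType) (S S1 : R -> R).
Hypotheses (S_gt0 : forall x, 0 < S x)
  (dS : \forall x \near +oo, is_derive (x : R) 1 S (S1 x))
  (S1_cvg0 : S1 x @[x --> +oo] --> 0).

Let S_lipschitz (e : R) : 0 < e -> exists A : R, forall y, A < y ->
  is_derive y 1 S (S1 y) /\ `|S1 y| <= e.
Proof.
move=> e0; have S1e : \forall x \near +oo, `|S1 x| <= e.
  have /cvgrPdist_le := S1_cvg0 => /(_ e e0).
  by apply: filterS => x; rewrite sub0r normrN.
have [A [_ HA]] : \forall x \near +oo, is_derive (x : R) 1 S (S1 x) /\ `|S1 x| <= e.
  by near=> x; split; near: x.
by exists A.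
Unshelve. all: by end_near. Qed.

Lemma self_neglecting_sublinear (e : R) : 0 < e -> \forall x \near +oo, S x <= e * x.
Proof.
move=> e0; have e20 : 0 < e / 2 by rewrite divr_gt0.
have [A HA] := S_lipschitz e20.
pose B := A + 1.
near=> x; have Bx : B <= x by near: x; exact/nbhs_pinfty_ge/num_real.
have AB : A < B by rewrite ltrDl.
have [d1 d2] : (forall y, Num.min B x <= y <= Num.max B x ->
      is_derive y 1 S (S1 y)) /\
    (forall y, Num.min B x <= y <= Num.max B x -> `|S1 y| <= e / 2).
  rewrite (min_idPl Bx) (max_idPr Bx).
  by split=> y /andP[/(lt_le_trans AB)/HA[]].
have := mean_value_le d1 d2; rewrite [X in _ * X]ger0_norm ?subr_ge0// => /(le_trans (ler_norm _)) h.
have : (2 / e) * (S B - e / 2 * B) <= x by near: x; exact/nbhs_pinfty_ge/num_real.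
rewrite -ler_pdivlMl; last by rewrite divr_gt0.
rewrite invf_div; lra.
Unshelve. all: by end_near. Qed.

(** Since S x = o(x), points within a bounded number of units S x of x still
    tend to infinity with x. *)
Lemma self_neglecting_far (A V : R) : \forall x \near +oo, forall v,
  `|v| <= V -> A <= x + S x * v.
Proof.
pose W := `|V| + 1.
have W0 : 0 < W by rewrite /W ltr_pwDr.
have e0 : 0 < (2 * W)^-1 by rewrite invr_gt0 mulr_gt0.
near=> x => v vV.
have xA : 2 * A <= x by near: x; exact/nbhs_pinfty_ge/num_real.
have x0 : 0 <= x by near: x; exact/nbhs_pinfty_ge/num_real.
have Sx : S x <= (2 * W)^-1 * x.
  by near: x; exact: self_neglecting_sublinear.
have vW : `|v| <= W by rewrite (le_trans vV)// /W (le_trans (ler_norm V))// lerDl.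
have : `|S x * v| <= x / 2.
  rewrite normrM (gtr0_norm (S_gt0 x)).
  rewrite (le_trans (ler_pM (ltW (S_gt0 x)) (normr_ge0 v) Sx vW))//.
  by rewrite (_ : _ * x * W = x / 2)//; field; rewrite gt_eqF.
rewrite ler_norml => /andP[+ _]; lra.
Unshelve. all: by end_near. Qed.

(** A function whose derivative tends to 0 varies by o(S x) over a distance
    O(S x). *)
Lemma self_neglecting_ratio (e V : R) : 0 < e -> \forall x \near +oo, forall v,
  `|v| <= V -> `|S (x + S x * v) - S x| <= e * S x.
Proof.
move=> e0.
pose W := `|V| + 1.
have W0 : 0 < W by rewrite /W ltr_pwDr.
have eW : 0 < e / W by rewrite divr_gt0.
have [A HA] := S_lipschitz eW.
near=> x => v vV.
have far : forall v, `|v| <= V -> A + 1 <= x + S x * v.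
  by near: x; exact: self_neglecting_far.
have xA : A + 1 <= x by near: x; exact/nbhs_pinfty_ge/num_real.
have rng (y : R) : Num.min x (x + S x * v) <= y <= Num.max x (x + S x * v) -> A < y.
  move=> /andP[+ _]; apply: lt_le_trans.
  have A1 : A < A + 1 by rewrite ltrDl.
  by rewrite lt_min (lt_le_trans A1 xA) (lt_le_trans A1 (far v vV)).
have d1 (y : R) : Num.min x (x + S x * v) <= y <= Num.max x (x + S x * v) ->
    is_derive y 1 S (S1 y) by move=> /rng/HA[].
have d2 (y : R) : Num.min x (x + S x * v) <= y <= Num.max x (x + S x * v) ->
    `|S1 y| <= e / W by move=> /rng/HA[].
apply: (le_trans (mean_value_le d1 d2)); rewrite addrAC subrr add0r normrM (gtr0_norm (S_gt0 x)).
rewrite mulrCA (mulrC e (S x)) ler_wpM2l ?(ltW (S_gt0 x))//.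
rewrite -mulrA ler_piMr ?(ltW e0)// mulrC ler_pdivrMr// mul1r.
by rewrite (le_trans vV)// /W (le_trans (ler_norm V))// lerDl.
Unshelve. all: by end_near. Qed.

End self_neglecting.

(** * Steep convex functions *)

Lemma exprn_expRN_cvg0 (R : realType) (n : nat) :
  t ^+ n * expR (- t) @[t --> (+oo : set_system R)] --> (0 : R).
Proof.
have inv0 : t^-1 @[t --> (+oo : set_system R)] --> (0 : R).
  by apply/gtr0_cvgV0; [exact/nbhs_pinfty_gt/num_real|exact: cvg_id].
apply: (@squeeze_cvgr _ _ _ _ (cst 0) (fun t => n.+1`!%:R * t^-1)).
- near=> t.
  have t0 : 0 < t by near: t; exact/nbhs_pinfty_gt/num_real.
  rewrite mulr_ge0 ?expR_ge0 ?exprn_ge0 ?(ltW t0)//=.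
  rewrite expRN ler_pdivrMr ?expR_gt0// mulrAC ler_pdivlMr// -exprSr.
  rewrite -ler_pdivrMl ?ltr0n ?fact_gt0// mulrC.
  by rewrite (le_trans _ (expR_ge1Dxn n (ltW t0)))// lerDr.
- exact: cvg_cst.
- by rewrite -[X in _ --> X](mulr0 n.+1`!%:R); apply: cvgM => //; exact: cvg_cst.
Unshelve. all: by end_near. Qed.

Lemma invr_sqr_dist_le (R : realType) (e r : R) :
  e <= 1 / 2 -> `|r - 1| <= e -> `|1 - (r ^+ 2)^-1| <= 10 * e.
Proof.
move=> e12; rewrite ler_norml => /andP[r1 r2].
have r14 : 1 / 4 <= r ^+ 2 by nra.
have r20 : 0 < r ^+ 2 by rewrite (lt_le_trans _ r14).
have -> : 1 - (r ^+ 2)^-1 = (r - 1) * (r + 1) / r ^+ 2.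
  by field; move: r20; apply: contraL => /eqP ->; rewrite expr0n/= ltxx.
rewrite normrM [X in _ * X]ger0_norm ?invr_ge0 ?sqr_ge0// ler_pdivrMr//.
by rewrite ler_norml; apply/andP; split; nra.
Qed.

(** The square root of 1 / h1 x: the standard deviation of the Gaussian that has
    the same curvature as the tilted density at its peak x. The exponential form
    makes it positive everywhere. *)
Definition spread (R : realType) (h1 : R -> R) (x : R) : R :=
  expR (- (ln (h1 x) / 2)).

(** The common feature of regularly and rapidly varying slopes h on which the
    whole argument rests. The middle condition bounds (ln h1)' by a multiple of
    (ln h)'; the last one says that the relative change of h over a distance
    [spread h1 x] tends to 0. *)
Definition steep_derivatives (R : realType) (h h1 h2 : R -> R) (C : R) : Prop :=
  [/\ \forall x \near +oo, 0 < h1 x,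
      \forall x \near +oo, `|h2 x| * h x <= C * h1 x ^+ 2 &
      h1 x / h x ^+ 2 @[x --> +oo] --> 0].

Section steep.
Variables (R : realType) (g h h1 h2 : R -> R) (C : R).
Hypotheses (dg : forall x : R, 0 < x -> is_derive x 1 g (h x))
  (dh : forall x : R, 0 < x -> is_derive x 1 h (h1 x))
  (dh1 : forall x : R, 0 < x -> is_derive x 1 h1 (h2 x))
  (h_mono : forall x y : R, 0 < x -> x <= y -> h x <= h y)
  (hy : h x @[x --> +oo] --> +oo)
  (h_steep : steep_derivatives h h1 h2 C).

Let h1_gt0 : \forall x \near +oo, 0 < h1 x.
Proof. by have [] := h_steep. Qed.

Let h2_le : \forall x \near +oo, `|h2 x| * h x <= C * h1 x ^+ 2.
Proof. by have [] := h_steep. Qed.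

Let h1_h2 : h1 x / h x ^+ 2 @[x --> +oo] --> 0.
Proof. by have [] := h_steep. Qed.

Let S := spread h1.

Lemma spread_gt0 x : 0 < S x. Proof. exact: expR_gt0. Qed.

Lemma spread_sqr x : 0 < h1 x -> S x ^+ 2 * h1 x = 1.
Proof.
move=> h10; rewrite /S /spread -expRM_natl mulrN mulrCA mulfV ?pnatr_eq0// mulr1.
by rewrite expRN lnK ?posrE// mulVf// gt_eqF.
Qed.

Let S1 x := S x * - (h2 x / (2 * h1 x)).

Lemma is_derive_spread : \forall x \near +oo, is_derive (x : R) 1 S (S1 x).
Proof.
near=> x.
have x0 : 0 < x by near: x; exact/nbhs_pinfty_gt/num_real.
have h10 : 0 < h1 x by near: x.
have dln : is_derive x 1 (@ln R \o h1) ((h1 x)^-1 * h2 x).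
  by apply: is_derive1_comp; [exact: is_derive1_ln|exact: dh1].
have dE : is_derive x 1 (fun x => - (2^-1 *: (@ln R \o h1) x))
    (- (h2 x / (2 * h1 x))).
  apply: is_derive_eq; rewrite /GRing.scale/=; field; rewrite gt_eqF//.
have -> : S = expR \o (fun x => - (2^-1 *: (@ln R \o h1) x)).
  by apply/funext => y; rewrite /S /spread /= /GRing.scale/= mulrC.
have -> : S1 x = expR (- (2^-1 *: (@ln R \o h1) x)) * - (h2 x / (2 * h1 x)).
  by rewrite /S1 /S /spread /= /GRing.scale/= mulrC [ln _ / 2]mulrC mulrC.
exact: is_derive1_comp.
Unshelve. all: by end_near. Qed.

(** S1 is of the order of h2 / h1^(3/2), which the bound on h2 makes at most of
    the order of sqrt h1 / h. Hence the spread is self-neglecting. *)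
Lemma derive_spread_cvg0 : S1 x @[x --> +oo] --> 0.
Proof.
apply/cvgr0Pnorm_le => e e0.
have c0 : 0 < 4 * e ^+ 2 / (C ^+ 2 + 1).
  by rewrite divr_gt0 ?mulr_gt0 ?exprn_gt0// ltr_pwDr ?sqr_ge0.
near=> x.
have h10 : 0 < h1 x by near: x.
have h0 : 0 < h x by near: x; move/cvgryPgt: hy; exact.
have h2x : `|h2 x| * h x <= C * h1 x ^+ 2 by near: x.
have r0 : 0 <= h1 x / h x ^+ 2 by rewrite divr_ge0 ?sqr_ge0// ltW.
have re : h1 x / h x ^+ 2 <= 4 * e ^+ 2 / (C ^+ 2 + 1).
  near: x; move/cvgr0Pnorm_le : h1_h2 => /(_ _ c0); apply: filterS => y.
  exact/le_trans/ler_norm.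
rewrite -(@ler_pXn2r _ 2)// ?nnegrE// ?(ltW e0)// real_normK ?num_real//.
rewrite /S1 exprMn sqrrN expr_div_n exprMn.
have -> : S x ^+ 2 = (h1 x)^-1.
  by apply: (mulIf (lt0r_neq0 h10)); rewrite spread_sqr// mulVf ?gt_eqF.
rewrite -[h2 x ^+ 2]real_normK ?num_real//.
have h2C : `|h2 x| <= C * h1 x ^+ 2 / h x by rewrite ler_pdivlMr.
have h2C2 : `|h2 x| ^+ 2 <= (C * h1 x ^+ 2 / h x) ^+ 2.
  by rewrite ler_pXn2r// nnegrE// (le_trans _ h2C).
apply: (@le_trans _ _ ((h1 x)^-1 *
    ((C * h1 x ^+ 2 / h x) ^+ 2 / (2 ^+ 2 * h1 x ^+ 2)))).
  rewrite ler_wpM2l ?invr_ge0 ?(ltW h10)// ler_wpM2r//.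
  by rewrite invr_ge0 mulr_ge0 ?sqr_ge0.
have -> : (h1 x)^-1 * ((C * h1 x ^+ 2 / h x) ^+ 2 / (2 ^+ 2 * h1 x ^+ 2)) =
    C ^+ 2 / 4 * (h1 x / h x ^+ 2).
  by field; rewrite !gt_eqF.
apply: (@le_trans _ _ (C ^+ 2 / 4 * (4 * e ^+ 2 / (C ^+ 2 + 1)))).
  by rewrite ler_wpM2l// divr_ge0 ?sqr_ge0.
rewrite [leLHS](_ : _ = e ^+ 2 * (C ^+ 2 / (C ^+ 2 + 1))); last first.
  by field; rewrite gt_eqF// ltr_pwDr ?sqr_ge0.
rewrite ler_piMr ?sqr_ge0// ler_pdivrMr ?mul1r ?lerDl//.
by rewrite ltr_pwDr ?sqr_ge0.
Unshelve. all: by end_near. Qed.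

Lemma spread_far (A V : R) : \forall x \near +oo, forall v,
  `|v| <= V -> A <= x + S x * v.
Proof.
exact: (self_neglecting_far spread_gt0 is_derive_spread derive_spread_cvg0).
Qed.

(** The gap between g and its tangent at x, at u spreads from x: the exponent lost
    by the tilted density with respect to its peak. *)
Definition bregman x u := g (x + S x * u) - g x - h x * (S x * u).

(** By Taylor's formula the gap is u^2 / 2 times (S x / S c)^2 for some c within
    |u| spreads of x, and this ratio tends to 1 because S is self-neglecting. *)
Lemma bregman_cvg (u : R) : bregman x u @[x --> +oo] --> u ^+ 2 / 2.
Proof.
apply/cvgrPdist_le => eps eps0.
(* If S c / S x is within e of 1 then the square of its inverse is within 10 e
   of 1, and the factor u ^ 2 / 2 turns 10 into 5. *)
pose e := Num.min (1 / 2) (eps / (5 * u ^+ 2 + 1)).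
have u1 : 0 < 5 * u ^+ 2 + 1 by rewrite ltr_pwDr// mulr_ge0 ?sqr_ge0.
have e0 : 0 < e by rewrite lt_min !divr_gt0.
have e12 : e <= 1 / 2 by rewrite /e ge_min lexx.
have eeps : e * (5 * u ^+ 2 + 1) <= eps.
  by rewrite -ler_pdivlMr// /e ge_min lexx orbT.
near=> x.
have x0 : 0 < x by near: x; exact/nbhs_pinfty_gt/num_real.
have h10 : 0 < h1 x by near: x.
have far (v : R) : `|v| <= `|u| -> 1 <= x + S x * v.
  by move: v; near: x; exact: spread_far.
have ratio (v : R) : `|v| <= `|u| -> `|S (x + S x * v) - S x| <= e * S x.
  move: v; near: x.
  exact: (self_neglecting_ratio spread_gt0 is_derive_spread derive_spread_cvg0).
have posh (v : R) : `|v| <= `|u| -> 0 < h1 (x + S x * v).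
  move: v; near: x.
  have [M [_ HM]] := h1_gt0.
  apply: filterS (spread_far (M + 1) `|u|) => y Hy v /Hy Mv.
  by apply: HM; rewrite (lt_le_trans _ Mv)// ltrDl.
pose y := x + S x * u.
have rng (z : R) : Num.min x y <= z <= Num.max x y ->
    exists2 v, `|v| <= `|u| & z = x + S x * v.
  move=> zxy; exists ((z - x) / S x); last first.
    by rewrite mulrC divfK ?gt_eqF ?spread_gt0// subrKC.
  rewrite normrM normfV (gtr0_norm (spread_gt0 x)) ler_pdivrMr ?spread_gt0//.
  have -> : `|u| * S x = `|y - x|.
    by rewrite /y addrAC subrr add0r normrM (gtr0_norm (spread_gt0 x)) mulrC.
  move: zxy; case: (leP x y) => xy /andP[xz zy].
    by rewrite !ger0_norm ?subr_ge0// lerD2r.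
  by rewrite !ler0_norm ?subr_le0 ?(ltW xy)// lerN2 lerD2r.
have rng0 (z : R) : Num.min x y <= z <= Num.max x y -> 0 < z.
  by move=> /rng[v /far vu ->]; exact: lt_le_trans vu.
have [|c /rng[v vu cE] gE] := @taylor_order2 _ g h h1 x y (fun z zxy => dg (rng0 z zxy)).
  by move=> z /rng0; exact: dh.
have -> : bregman x u = h1 c / 2 * (S x * u) ^+ 2.
  rewrite /bregman -/y gE (_ : y - x = S x * u); last by rewrite /y addrAC subrr add0r.
  ring.
have hc0 : 0 < h1 c by rewrite cE posh.
pose r := S c / S x.
have Sx0 := spread_gt0 x; have Sc0 := spread_gt0 c.
have r0 : 0 < r by rewrite divr_gt0.
have -> : h1 c / 2 * (S x * u) ^+ 2 = u ^+ 2 / 2 * (r ^+ 2)^-1.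
  have := spread_sqr hc0; rewrite /r => Sc1.
  have -> : h1 c = (S c ^+ 2)^-1.
    by apply: (mulfI (lt0r_neq0 (exprn_gt0 2 Sc0))); rewrite Sc1 mulfV ?gt_eqF ?exprn_gt0.
  by field; rewrite !gt_eqF.
have r1 : `|r - 1| <= e.
  have -> : r - 1 = (S c - S x) / S x by rewrite /r; field; rewrite gt_eqF.
  rewrite normrM normfV (gtr0_norm Sx0) ler_pdivrMr// cE; exact: ratio.
have rr := invr_sqr_dist_le e12 r1.
rewrite -[X in X - _]mulr1 -mulrBr normrM.
apply: (le_trans (ler_wpM2l (normr_ge0 _) rr)).
rewrite ger0_norm ?divr_ge0 ?sqr_ge0//.
apply: le_trans eeps.
have : 0 <= e * u ^+ 2 by rewrite mulr_ge0 ?sqr_ge0// ltW.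
lra.
Unshelve. all: by end_near. Qed.

Lemma tangent_le (a b : R) : 0 < a -> 0 < b -> g a + h a * (b - a) <= g b.
Proof.
move=> a0 b0; have [ab|ba|->] := ltgtP a b; last by rewrite subrr mulr0 addr0.
- have [||c cab] := @MVT _ g h a b ab.
  + by move=> y; rewrite in_itv/= => /andP[ay _]; apply/dg/(lt_trans a0).
  + apply: derivable_within_continuous => y; rewrite in_itv/= => /andP[ay _].
    by have := dg (lt_le_trans a0 ay) => ?; exact: ex_derive.
  move: cab; rewrite in_itv/= => /andP[ac _].
  have := h_mono a0 (ltW ac); nra.
- have [||c cab] := @MVT _ g h b a ba.
  + by move=> y; rewrite in_itv/= => /andP[ay _]; apply/dg/(lt_trans b0).
  + apply: derivable_within_continuous => y; rewrite in_itv/= => /andP[ay _].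
    by have := dg (lt_le_trans b0 ay) => ?; exact: ex_derive.
  move: cab; rewrite in_itv/= => /andP[bc ca].
  have := h_mono (lt_trans b0 bc) (ltW ca); nra.
Qed.

(** The gap is convex in u and vanishes at 0, so that it grows at least linearly
    beyond u = 1 and u = -1, where it is close to 1 / 2. This is the domination
    needed in Laplace's method, uniform in x. *)
Lemma bregman_ge : \forall x \near +oo, forall u, 0 < x + S x * u ->
  (`|u| - 1) / 4 <= bregman x u.
Proof.
have near1 (u : R) : u ^+ 2 = 1 -> \forall x \near +oo, 1 / 4 <= bregman x u.
  move=> u1; have := @bregman_cvg u; rewrite u1 => /cvgrPdist_le.
  move=> /(_ (1 / 4))/(_ _)[//|M [Mr HM]]; exists M; split=> // x /HM.
  by rewrite ler_norml => /andP[_]; lra.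
near=> x => u xu.
have Sx0 := spread_gt0 x.
have x0 : 0 < x by near: x; exact/nbhs_pinfty_gt/num_real.
have far (v : R) : `|v| <= 1 -> 1 <= x + S x * v by move: v; near: x; exact: spread_far.
have p1 : 1 / 4 <= bregman x 1 by near: x; apply: near1; rewrite expr1n.
have m1 : 1 / 4 <= bregman x (-1) by near: x; apply: near1; rewrite sqrrN expr1n.
have y10 : 0 < x + S x * 1.
  by apply: (@lt_le_trans _ _ 1) => //; apply: far; rewrite normr1.
have y20 : 0 < x + S x * -1.
  by apply: (@lt_le_trans _ _ 1) => //; apply: far; rewrite normrN1.
have b0 := tangent_le x0 xu.
move: p1 m1; rewrite /bregman => p1 m1.
have t1 := tangent_le y10 xu; have t2 := tangent_le y10 x0.
have t3 := tangent_le y20 xu; have t4 := tangent_le y20 x0.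
have [u1|u1] := leP `|u| 1; first by lra.
have [u0|u0] := leP 0 u.
  rewrite (ger0_norm u0) in u1 *.
  move: t1 t2 p1; move: (g (x + S x * u)) (g (x + S x * 1)) (h (x + S x * 1)).
  move=> gu g1 k; rewrite !mulr1 => t1 t2 p1.
  have u10 : 0 <= u - 1 by rewrite subr_ge0 ltW.
  have := ler_wpM2l u10 t2; have := ler_wpM2l u10 p1; lra.
rewrite (ltr0_norm u0) in u1 *.
move: t3 t4 m1; move: (g (x + S x * u)) (g (x + S x * -1)) (h (x + S x * -1)).
move=> gu g1 k; rewrite !mulrN1 => t3 t4 m1.
have u10 : 0 <= - u - 1 by rewrite subr_ge0 ltW.
have := ler_wpM2l u10 t4; have := ler_wpM2l u10 m1; lra.
Unshelve. all: by end_near. Qed.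

(** For a power N >= C the condition on h2 makes h^(N+1) h1 nondecreasing, hence
    bounded below; its primitive is a multiple of h^(N+2), which therefore grows
    at least linearly. *)
Lemma argument_polynomial_bound : exists N A, 0 <= A /\
  \forall x \near +oo, x <= A * h x ^+ N.
Proof.
have [N CN] : exists N : nat, C <= N%:R.
  exists (Num.truncn C).+1; exact/ltW/truncnS_gt.
pose w x := h x ^+ N.+1 * h1 x.
have h_gt1 : \forall x \near +oo, 1 < h x by move/cvgryPgt: hy; exact.
have [B [_ HB]] : \forall x \near +oo, [/\ 0 < x, 0 < h1 x, 1 < h x &
    `|h2 x| * h x <= C * h1 x ^+ 2].
  near=> x; split; near: x => //; exact/nbhs_pinfty_gt/num_real.
pose x0 := B + 1.
have Bx0 : B < x0 by rewrite ltrDl.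
have [x00 h1x00 hx01 _] := HB _ Bx0.
have dw (y : R) : x0 <= y -> is_derive y 1 w
    (h y ^+ N * (N.+1%:R * h1 y ^+ 2 + h y * h2 y)).
  move=> x0y; have [y0 _ _ _] := HB _ (lt_le_trans Bx0 x0y).
  have dhy := dh y0; have dh1y := dh1 y0.
  have -> : w = h ^+ N.+1 * h1 by apply/funext => z; rewrite /w exprfctE.
  apply: is_derive_eq; rewrite /GRing.scale/= exprfctE exprS; ring.
have dpow (y : R) : x0 <= y -> is_derive y 1 (fun z => h z ^+ N.+2) (N.+2%:R * w y).
  move=> x0y; have [y0 _ _ _] := HB _ (lt_le_trans Bx0 x0y).
  have dhy := dh y0.
  have -> : (fun z => h z ^+ N.+2) = h ^+ N.+2.
    by apply/funext => z; rewrite exprfctE.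
  by apply: is_derive_eq; rewrite /GRing.scale/= /w mulrA.
have w_ge (x : R) : x0 <= x -> w x0 <= w x.
  move=> x0x; have [||c cab] := @MVT_segment _ w
      (fun y => h y ^+ N * (N.+1%:R * h1 y ^+ 2 + h y * h2 y)) x0 x x0x.
  - by move=> y; rewrite in_itv/= => /andP[/ltW + _]; exact: dw.
  - apply: derivable_within_continuous => y; rewrite in_itv/= => /andP[/dw ? _].
    exact: ex_derive.
  move: cab; rewrite in_itv/= => /andP[x0c _] wE.
  rewrite -subr_ge0 wE mulr_ge0 ?subr_ge0//.
  have [_ h1c hc hC] := HB _ (lt_le_trans Bx0 x0c).
  rewrite mulr_ge0 ?exprn_ge0 ?(ltW (lt_trans ltr01 hc))//.
  have : - (`|h2 c| * h c) <= h c * h2 c.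
    by rewrite -mulNr mulrC ler_wpM2l ?(ltW (lt_trans ltr01 hc))// lerNl ler_normr lexx orbT.
  have : C * h1 c ^+ 2 <= N%:R * h1 c ^+ 2 by rewrite ler_wpM2r ?sqr_ge0.
  rewrite -natr1 mulrDl mul1r; have := sqr_ge0 (h1 c); lra.
have w0 : 0 < w x0 by rewrite mulr_gt0// exprn_gt0// (lt_trans ltr01).
exists N.+2, (x0 + (w x0)^-1); split.
  by rewrite addr_ge0 ?invr_ge0 ?(ltW w0) ?(ltW x00).
near=> x.
have x0x : x0 <= x by near: x; exact/nbhs_pinfty_ge/num_real.
have hx1 : 1 <= h x ^+ N.+2.
  by rewrite exprn_ege1// (le_trans (ltW hx01))// h_mono.
have [||c cab] := @MVT_segment _ (fun z => h z ^+ N.+2)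
    (fun y => N.+2%:R * w y) x0 x x0x.
- by move=> y; rewrite in_itv/= => /andP[/ltW + _]; exact: dpow.
- apply: derivable_within_continuous => y; rewrite in_itv/= => /andP[/dpow ? _].
  exact: ex_derive.
move: cab; rewrite in_itv/= => /andP[x0c _] wE.
have h0 : 0 <= h x0 ^+ N.+2 by rewrite exprn_ge0// ltW// (lt_trans ltr01).
have wc := w_ge _ x0c.
have Nw : w x0 <= N.+2%:R * w c.
  rewrite (le_trans wc)// ler_peMl ?ler1n// (le_trans _ wc)// ltW//.
have : w x0 * (x - x0) <= h x ^+ N.+2.
  have : w x0 * (x - x0) <= N.+2%:R * w c * (x - x0).
    by rewrite ler_wpM2r// subr_ge0.
  lra.
rewrite -ler_pdivlMl// mulrDl => ?.
have : x0 * 1 <= x0 * h x ^+ N.+2 by rewrite ler_wpM2l// ltW.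
lra.
Unshelve. all: by end_near. Qed.

(** The exponent at the peak is at least h x - g 1, by comparison with the tangent
    at x evaluated at 1, whereas x and 1 / S x are at most powers of h x. *)
Lemma left_tail_cvg0 :
  expR (- (h x * x - g x)) / S x * (1 + (4 + 2 * x ^+ 2) / S x ^+ 2)
    @[x --> +oo] --> 0.
Proof.
have [N [A [A0 xA]]] := argument_polynomial_bound.
pose M := (N + N).+3.
pose B := expR (g 1) * (5 + 2 * A ^+ 2).
have cv : B * (h x ^+ M * expR (- h x)) @[x --> +oo] --> 0.
  rewrite -[X in _ --> X](mulr0 B); apply: cvgM; first exact: cvg_cst.
  exact: (cvg_comp _ _ hy (@exprn_expRN_cvg0 R M)).
apply: (squeeze_cvgr _ (cvg_cst 0) cv).
near=> x.
have x1 : 1 <= x by near: x; exact/nbhs_pinfty_ge/num_real.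
have x0 : 0 < x by rewrite (lt_le_trans ltr01).
have h10 : 0 < h1 x by near: x.
have hx1 : 1 < h x by near: x; move/cvgryPgt: hy; exact.
have hx0 : 0 < h x by rewrite (lt_trans ltr01).
have xAx : x <= A * h x ^+ N by near: x.
have h1h : h1 x <= h x ^+ 2.
  have : h1 x / h x ^+ 2 <= 1.
    near: x; move/cvgr0Pnorm_le : h1_h2 => /(_ _ ltr01); apply: filterS => x.
    exact/le_trans/ler_norm.
  by rewrite ler_pdivrMr ?exprn_gt0// mul1r.
have Sx0 := spread_gt0 x.
have Sh : (S x ^+ 2)^-1 = h1 x.
  apply: (mulfI (lt0r_neq0 (exprn_gt0 2 Sx0))).
  by rewrite spread_sqr// mulfV ?gt_eqF ?exprn_gt0.
have Si : (S x)^-1 <= h x.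
  rewrite -(@ler_pXn2r _ 2)// ?nnegrE ?invr_ge0 ?(ltW Sx0) ?(ltW hx0)//.
  by rewrite exprVn Sh.
have q0 : 0 <= 1 + (4 + 2 * x ^+ 2) / S x ^+ 2.
  by rewrite addr_ge0// divr_ge0 ?sqr_ge0// addr_ge0// mulr_ge0// sqr_ge0.
apply/andP; split.
  by rewrite mulr_ge0// divr_ge0 ?expR_ge0// ltW.
have K : expR (- (h x * x - g x)) <= expR (g 1) * expR (- h x).
  rewrite -expRD ler_expR; have := tangent_le x0 ltr01; lra.
have Q : 1 + (4 + 2 * x ^+ 2) / S x ^+ 2 <= (5 + 2 * A ^+ 2) * h x ^+ (N + N).+2.
  rewrite Sh.
  have hN1 : 1 <= h x ^+ (N + N) by rewrite exprn_ege1// ltW.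
  have h21 : 1 <= h x ^+ 2 by rewrite exprn_ege1// ltW.
  have x2 : x ^+ 2 <= A ^+ 2 * h x ^+ (N + N).
    rewrite exprD -expr2 -exprMn ler_pXn2r ?nnegrE ?(ltW x0)//.
    by rewrite mulr_ge0// exprn_ge0// ltW.
  rewrite -[(N + N).+2]addn2 exprD mulrA.
  have : (4 + 2 * x ^+ 2) * h1 x <= (4 + 2 * x ^+ 2) * h x ^+ 2.
    by rewrite ler_wpM2l// addr_ge0// mulr_ge0// sqr_ge0.
  have : (4 + 2 * x ^+ 2) * h x ^+ 2 <=
      (4 * h x ^+ (N + N) + 2 * (A ^+ 2 * h x ^+ (N + N))) * h x ^+ 2.
    by rewrite ler_wpM2r ?sqr_ge0//; lra.
  have : 1 * 1 <= h x ^+ (N + N) * h x ^+ 2 by rewrite ler_pM.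
  nra.
apply: (@le_trans _ _ ((expR (g 1) * expR (- h x) * h x) *
    ((5 + 2 * A ^+ 2) * h x ^+ (N + N).+2))).
  apply: ler_pM => //; first by rewrite divr_ge0 ?expR_ge0// ltW.
  by apply: ler_pM => //; rewrite ?expR_ge0// invr_ge0 ltW.
rewrite /B /M [h x ^+ (N + N).+3]exprS le_eqVlt; apply/orP; left; apply/eqP; ring.
Unshelve. all: by end_near. Qed.

End steep.

(** * Regular and rapid variation *)

(** Along a dyadic sequence f decreases geometrically, and a bound for f on one
    dyadic block makes this uniform. Boundedness thus replaces the measurability
    that the uniform convergence theorem would require. *)
Lemma regularly_varying_cvg0 (R : realType) (f : R -> R) (eta A B : R) :
    (forall x, 0 <= f x) -> (forall x, A <= x -> f x <= B) ->
    regularly_varying f eta -> eta < 0 ->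
  f x @[x --> +oo] --> 0.
Proof.
move=> f0 fB rv eta0.
pose rho : R := 2 `^ eta.
have rho_gt0 : 0 < rho by exact: powR_gt0.
have rho_lt1 : rho < 1.
  by rewrite /rho /powR pnatr_eq0/= expR_lt1 pmulr_llt0// ln_gt0// ltr1n.
pose r := (1 + rho) / 2.
have r0 : 0 <= r by rewrite /r; lra.
have r1 : r < 1 by rewrite /r; lra.
pose e := Num.min ((1 - rho) / 2) (rho / 2).
have e0 : 0 < e by rewrite lt_min !divr_gt0// subr_gt0.
have er : rho + e <= r.
  have : e <= (1 - rho) / 2 by rewrite /e ge_min lexx.
  rewrite /r; lra.
have erho : e < rho.
  have : e <= rho / 2 by rewrite /e ge_min lexx orbT.
  lra.
have [A1 [_ HA1]] : \forall x \near +oo, f (2 * x) <= r * f x.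
  have /cvgrPdist_le/(_ _ e0) := rv 2 (ltr0n _ 2).
  apply: filterS => x; rewrite -/rho ler_norml => /andP[h1 h2].
  have [fx0|fx0] := eqVneq (f x) 0.
    by move: h2; rewrite fx0 invr0 mulr0 subr0; lra.
  rewrite -ler_pdivrMr; last by rewrite lt0r fx0 f0.
  lra.
pose X0 := Num.max 1 (Num.max A (A1 + 1)).
have X01 : 1 <= X0 by rewrite /X0 le_max lexx.
have X0A : A <= X0 by rewrite /X0 !le_max lexx orbT.
have X0A1 : A1 < X0 by rewrite /X0 !lt_max ltrDl ltr01 !orbT.
have step n x : X0 <= x -> f (2 ^+ n * x) <= r ^+ n * B.
  move=> X0x; elim: n => [|n IH].
    by rewrite !expr0 !mul1r fB// (le_trans X0A).
  rewrite exprS -mulrA; apply: (le_trans (HA1 _ _)).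
    rewrite (lt_le_trans X0A1)// (le_trans X0x)// ler_peMl ?exprn_ege1 ?ler1n//.
    by rewrite (le_trans _ X0x)// (le_trans _ X01).
  by rewrite exprS -mulrA ler_wpM2l.
apply/cvgr0Pnorm_le => eps eps0.
have [n nB] : exists n, r ^+ n * B <= eps.
  have : r ^+ n * B @[n --> \oo] --> 0 * B.
    by apply: cvgM; [apply: cvg_expr; rewrite ger0_norm|exact: cvg_cst].
  rewrite mul0r => /cvgr0Pnorm_le/(_ _ eps0)[N _ HN].
  by exists N; apply: le_trans (HN N (leqnn N)); exact: ler_norm.
near=> y; rewrite ger0_norm//.
have -> : y = 2 ^+ n * (y / 2 ^+ n).
  by rewrite mulrC divfK// expf_neq0.
apply: (le_trans (step n _ _) nB).
by rewrite ler_pdivlMr ?exprn_gt0.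
Unshelve. all: by end_near. Qed.

Lemma is_derive_karamata (R : realType) (c : R) (eps : R -> R) (x : R) :
    twice_derivable_from1 eps -> 1 < x ->
  is_derive x 1 (karamata c eps) (karamata c eps x * (eps x / x)).
Proof.
move=> eps2 x1; pose f u := eps u / u.
have cf u : 1 <= u -> {for u, continuous f}.
  move=> u1; apply: cvgM.
    have [/derivable1_diffP deps _] := eps2 u u1.
    exact: (differentiable_continuous deps).
  by apply: cvgV => //; rewrite gt_eqF// (lt_le_trans ltr01).
have intf : lebesgue_measure.-integrable `[1, x + 1] (EFin \o f).
  apply: continuous_compact_integrable; first exact: segment_compact.
  apply: continuous_in_subspaceT => u; rewrite inE/= in_itv/= => /andP[u1 _].
  exact: cf.
have xx1 : x < x + 1 by rewrite ltrDl.
have [dF FE] := continuous_FTC1_closed xx1 intf x1 (cf x (ltW x1)).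
have dFx : is_derive x 1 (fun y => \int[lebesgue_measure]_(u in `[1, y]) f u)
    (f x).
  by apply: DeriveDef; [exact: dF|rewrite -derive1E; exact: FE].
have -> : karamata c eps = (fun y => c *: (expR \o
    (fun y => \int[lebesgue_measure]_(u in `[1, y]) f u)) y) by [].
apply: is_derive_eq.
by rewrite /karamata -mulrA.
Qed.


Lemma near_pinfty_nbhs (R : realType) (Q : R -> Prop) :
    (\forall x \near +oo, Q x) ->
  \forall x \near +oo, \forall y \near x, Q y.
Proof.
move=> [A [_ HA]]; exists A; split=> [|x Ax]; first exact: num_real.
near=> y; apply: HA.
by near: y; exact: lt_nbhsr.
Unshelve. all: by end_near. Qed.

Section cases.
Variables (R : realType) (h h1 h2 : R -> R).
Hypotheses (dh : forall x : R, 0 < x -> is_derive x 1 h (h1 x))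
  (dh1 : forall x : R, 0 < x -> is_derive x 1 h1 (h2 x))
  (h_gt0 : forall x : R, 0 < x -> 0 < h x)
  (h_mono : forall x y : R, 0 < x -> x <= y -> h x <= h y)
  (hy : h x @[x --> +oo] --> +oo).

Lemma derive1_quotient (k k1 : R -> R) :
    (\forall x \near +oo, h1 x = h x / k x) ->
    (\forall x \near +oo, 0 < k x) ->
    (\forall x \near +oo, is_derive (x : R) 1 k (k1 x)) ->
  \forall x \near +oo, h2 x * h x = (1 - k1 x) * h1 x ^+ 2.
Proof.
move=> h1E k0 dk; near=> x.
have x0 : 0 < x by near: x; exact/nbhs_pinfty_gt/num_real.
have kx0 : 0 < k x by near: x.
have h1x : h1 x = h x / k x by near: x.
have h1E' : \forall y \near x, h1 y = h y / k y.
  by near: x; exact: near_pinfty_nbhs.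
have dkx : is_derive x 1 k (k1 x) by near: x.
have dhx := dh x0.
have kxn0 : k x != 0 by rewrite gt_eqF.
have d2 : is_derive x 1 (fun y => h y / k y)
    (h x * - ((k x) ^- 2 * k1 x) + (k x)^-1 * h1 x).
  have dV : is_derive x 1 (fun y => (k y)^-1) (- ((k x) ^- 2 * k1 x)).
    have -> : - ((k x) ^- 2 * k1 x) = - (k x) ^- 2 *: k1 x.
      by rewrite /GRing.scale/= mulNr.
    exact: is_deriveV.
  by apply: is_derive_eq.
have d2' : is_derive x 1 h1
    (h x * - ((k x) ^- 2 * k1 x) + (k x)^-1 * h1 x).
  apply: near_eq_is_derive d2.
  by move: h1E'; apply: filterS => y ->.
have -> : h2 x = h x * - ((k x) ^- 2 * k1 x) + (k x)^-1 * h1 x.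
  by rewrite -(@derive_val _ _ _ _ _ _ _ (dh1 x0)) (@derive_val _ _ _ _ _ _ _ d2').
by rewrite h1x; field.
Unshelve. all: by end_near. Qed.


(** If h' = h / k then h'' h / h'^2 = 1 - k' and h' / h^2 = 1 / (h k). Both classes
    of slopes are treated by finding k. *)
Lemma steep_derivatives_quotient (k k1 : R -> R) (B : R) :
    (\forall x \near +oo, h1 x = h x / k x) ->
    (\forall x \near +oo, 0 < k x) ->
    (\forall x \near +oo, is_derive (x : R) 1 k (k1 x)) ->
    (\forall x \near +oo, `|k1 x| <= B) ->
    h x * k x @[x --> +oo] --> +oo ->
  steep_derivatives h h1 h2 (1 + B).
Proof.
move=> h1E k0 dk k1B hk; split.
- near=> x; rewrite (near h1E x)//.
  have kx : 0 < k x by near: x.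
  have x0 : 0 < x by near: x; exact/nbhs_pinfty_gt/num_real.
  by rewrite divr_gt0// h_gt0.
- near=> x.
  have x0 : 0 < x by near: x; exact/nbhs_pinfty_gt/num_real.
  have -> : `|h2 x| * h x = `|h2 x * h x|.
    by rewrite normrM [X in _ = _ * X]gtr0_norm ?h_gt0.
  have -> : h2 x * h x = (1 - k1 x) * h1 x ^+ 2.
    by near: x; exact: (derive1_quotient h1E k0 dk).
  rewrite normrM [X in _ * X]ger0_norm ?sqr_ge0// ler_wpM2r ?sqr_ge0//.
  have k1Bx : `|k1 x| <= B by near: x.
  by rewrite (le_trans (ler_normB _ _))// normr1 lerD2l.
- have cv : (h x * k x)^-1 @[x --> +oo] --> 0.
    apply/gtr0_cvgV0 => //.
    near=> x; have x0 : 0 < x by near: x; exact/nbhs_pinfty_gt/num_real.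
    have kx : 0 < k x by near: x.
    by rewrite mulr_gt0// h_gt0.
  apply: cvg_trans cv; apply: near_eq_cvg; near=> x.
  have x0 : 0 < x by near: x; exact/nbhs_pinfty_gt/num_real.
  have kx : 0 < k x by near: x.
  rewrite (near h1E x)//; field.
  by rewrite !gt_eqF// h_gt0.
Unshelve. all: by end_near. Qed.

(** Here k x = x / (beta + eps x), by logarithmic differentiation of the
    representation of h. *)
Lemma regularly_varying_steep (beta theta : R) :
  regularly_varying_case h beta theta ->
  exists C, steep_derivatives h h1 h2 C.
Proof.
move=> [beta0 [c [eps [[c0 eps2] hE eps0 [M [_ HM]] _]]] _ _].
pose k x := x / (beta + eps x).
have epsb : \forall x \near +oo, beta / 2 <= beta + eps x <= 2 * beta.
  have b20 : 0 < beta / 2 by rewrite divr_gt0.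
  move/cvgr0Pnorm_le : eps0 => /(_ _ b20); apply: filterS => x.
  by rewrite ler_norml => /andP[? ?]; apply/andP; split; lra.
have h1E : \forall x \near +oo, h1 x = h x / k x.
  near=> x.
  have x1 : 1 < x by near: x; exact/nbhs_pinfty_gt/num_real.
  have x0 : 0 < x by rewrite (lt_trans ltr01).
  have b : beta / 2 <= beta + eps x <= 2 * beta by near: x.
  have dK := is_derive_karamata c eps2 x1.
  have dP : is_derive x 1 (fun y => y `^ beta) (beta * x `^ (beta - 1)).
    exact: is_derive1_powR.
  have d : is_derive x 1 (fun y => y `^ beta * karamata c eps y)
      (x `^ beta * (karamata c eps x * (eps x / x)) +
       karamata c eps x * (beta * x `^ (beta - 1))).
    by apply: is_derive_eq.
  have d' : is_derive x 1 h
      (x `^ beta * (karamata c eps x * (eps x / x)) +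
       karamata c eps x * (beta * x `^ (beta - 1))).
    apply: near_eq_is_derive d; near=> y; rewrite hE//; near: y.
    by apply: filterS (lt_nbhsr x1) => y /ltW.
  have -> : h1 x = x `^ beta * (karamata c eps x * (eps x / x)) +
       karamata c eps x * (beta * x `^ (beta - 1)).
    by rewrite -(@derive_val _ _ _ _ _ _ _ (dh x0)) (@derive_val _ _ _ _ _ _ _ d').
  have xb : x `^ (beta - 1) = x `^ beta / x.
    by rewrite powRB ?powRr1 ?(ltW x0)// (gt_eqF x0) implybT.
  rewrite (hE _ (ltW x1)) /k xb.
  by field; rewrite !gt_eqF//; move: b; lra.
have k0 : \forall x \near +oo, 0 < k x.
  near=> x.
  have x0 : 0 < x by near: x; exact/nbhs_pinfty_gt/num_real.
  have /andP[b _] : beta / 2 <= beta + eps x <= 2 * beta by near: x.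
  by rewrite divr_gt0// (lt_le_trans _ b)// divr_gt0.
pose k1 x := (beta + eps x)^-1 - x * eps^`()%classic x / (beta + eps x) ^+ 2.
have dk : \forall x \near +oo, is_derive (x : R) 1 k (k1 x).
  near=> x.
  have x1 : 1 <= x by near: x; exact/nbhs_pinfty_ge/num_real.
  have /andP[b _] : beta / 2 <= beta + eps x <= 2 * beta by near: x.
  have b0 : 0 < beta + eps x by rewrite (lt_le_trans _ b)// divr_gt0.
  have de : is_derive x 1 eps (eps^`()%classic x).
    by have [? _] := eps2 x x1; rewrite derive1E; exact: derivableP.
  have dV : is_derive x 1 (fun y => (beta + eps y)^-1)
      (- (beta + eps x) ^- 2 *: eps^`()%classic x).
    apply: is_deriveV; first by rewrite gt_eqF.
    have := is_deriveD (is_derive_cst beta x 1) de; rewrite add0r; exact.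
  rewrite /k /k1; apply: is_derive_eq; rewrite /GRing.scale/=.
  by field; rewrite gt_eqF.
have [M' M'ge] : exists M', M < M' by exists (M + 1); rewrite ltrDl.
have {}HM := HM _ M'ge.
exists (1 + (2 / beta + M' * (2 / beta) ^+ 2)).
apply: (steep_derivatives_quotient h1E k0 dk).
- near=> x.
  have x1 : 1 <= x by near: x; exact/nbhs_pinfty_ge/num_real.
  have /andP[b _] : beta / 2 <= beta + eps x <= 2 * beta by near: x.
  have b0 : 0 < beta + eps x by rewrite (lt_le_trans _ b)// divr_gt0.
  have bV : (beta + eps x)^-1 <= 2 / beta.
    by rewrite -[leRHS]invf_div lef_pV2// posrE divr_gt0.
  have xe : `|x * eps^`()%classic x| <= M'.
    have : `|x * `|eps^`()%classic x| | <= M' by near: x.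
    by rewrite normrM normr_id -normrM.
  rewrite /k1 (le_trans (ler_normB _ _))//; apply: lerD.
    by rewrite ger0_norm// invr_ge0 ltW.
  rewrite normrM; apply: ler_pM => //.
  rewrite ger0_norm ?invr_ge0 ?sqr_ge0// -exprVn.
  by rewrite ler_pXn2r// nnegrE ?invr_ge0 ?ltW// divr_gt0.
- apply/cvgryPge => A; near=> x.
  have x1 : 1 <= x by near: x; exact/nbhs_pinfty_ge/num_real.
  have /andP[b b2] : beta / 2 <= beta + eps x <= 2 * beta by near: x.
  have b0 : 0 < beta + eps x by rewrite (lt_le_trans _ b)// divr_gt0.
  have hx : `|A| * (2 * beta) <= h x by near: x; move/cvgryPge : hy; exact.
  have hx0 : 0 <= h x.
    by rewrite (le_trans _ hx)// !mulr_ge0// ltW.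
  rewrite /k mulrA ler_pdivlMr//.
  apply: (@le_trans _ _ (`|A| * (2 * beta))).
    apply: (@le_trans _ _ (`|A| * (beta + eps x))); last by rewrite ler_wpM2l.
    by rewrite ler_wpM2r ?(ltW b0)// ler_norm.
  by rewrite (le_trans hx)// ler_peMr.
Unshelve. all: by end_near. Qed.

(** Here k x = x * eps (h x), by differentiation of psi (h x) = x. Monotonicity of
    h forces eps to be positive at infinity, and then t * eps t is nondecreasing,
    so that h * k tends to infinity. *)
Lemma rapidly_varying_steep (psi : R -> R) :
    inverse_at_infty h psi -> rapidly_varying_case psi ->
  exists C, steep_derivatives h h1 h2 C.
Proof.
move=> [hpsi psih psiy] [_ [c [eps [[c0 eps2] psiE eps0 e1 _]]]].
have h_gt1 : \forall x \near +oo, 1 < h x by move/cvgryPgt: hy; exact.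
have chain : \forall x \near +oo, x * eps (h x) * h1 x = h x.
  near=> x.
  have x0 : 0 < x by near: x; exact/nbhs_pinfty_gt/num_real.
  have hx1 : 1 < h x by near: x.
  have hx0 : 0 < h x by rewrite (lt_trans ltr01).
  have psihx : psi (h x) = x by near: x.
  have psihx' : \forall y \near x, psi (h y) = y.
    by near: x; exact: near_pinfty_nbhs.
  have dK := is_derive_karamata c eps2 hx1.
  have dpsi : is_derive (h x) 1 psi (karamata c eps (h x) * (eps (h x) / h x)).
    apply: near_eq_is_derive dK; near=> y; rewrite psiE//; near: y.
    by apply: filterS (lt_nbhsr hx1) => y /ltW.
  have dhx := dh x0.
  have d1 := is_derive1_comp dpsi dhx.
  have d2 : is_derive x 1 id
      (karamata c eps (h x) * (eps (h x) / h x) * h1 x).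
    by apply: near_eq_is_derive d1.
  have := @derive_val _ _ _ _ _ _ _ d2; rewrite derive_id => d3.
  rewrite -{1}psihx psiE ?(ltW hx1)//.
  apply: (mulIf (invr_neq0 (lt0r_neq0 hx0))).
  by rewrite mulfV ?gt_eqF// [RHS]d3; ring.
have h1_ge0 : \forall x \near +oo, 0 <= h1 x.
  have [A [_ HA]] := psih.
  pose a := Num.max 0 A.
  exists a; split=> [|x ax]; first exact: num_real.
  have pos (y : R) : y \in `]a, +oo[%R -> 0 < y /\ psi (h y) = y.
    rewrite in_itv/= andbT /a gt_max => /andP[y0 Ay]; split => //; exact: HA.
  have [x0 _] : 0 < x /\ psi (h x) = x by apply: pos; rewrite in_itv/= andbT.
  have -> : h1 x = h^`()%classic x.
    by rewrite derive1E (@derive_val _ _ _ _ _ _ _ (dh x0)).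
  apply: (@incr_derive1_ge0_itvy _ _ false a x).
  - by move=> y; rewrite inE => /pos[y0 _]; have := dh y0 => ?; exact: ex_derive.
  - move=> y z /pos[y0 yE] /pos[z0 zE] yz.
    rewrite lt_neqAle h_mono ?(ltW yz)// andbT; apply/eqP => hyz.
    by move: yz; rewrite -yE -zE hyz ltxx.
  - by rewrite in_itv/= andbT.
have epsh_gt0 : \forall x \near +oo, 0 < eps (h x).
  near=> x.
  have x0 : 0 < x by near: x; exact/nbhs_pinfty_gt/num_real.
  have hx0 : 0 < h x by exact: h_gt0.
  have h1x : 0 <= h1 x by near: x.
  have E : x * eps (h x) * h1 x = h x by near: x.
  rewrite ltNge; apply/negP => e0.
  have : x * eps (h x) * h1 x <= 0.
    by rewrite mulr_le0_ge0// mulr_ge0_le0// ltW.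
  by rewrite E leNgt hx0.
have eps_gt0 : \forall t \near +oo, 0 < eps t.
  have H := psiy _ epsh_gt0.
  near=> t; have <- : h (psi t) = t by near: t.
  by near: t.
pose k x := x * eps (h x).
have k0 : \forall x \near +oo, 0 < k x.
  near=> x; have ex : 0 < eps (h x) by near: x.
  by rewrite mulr_gt0.
have h1E : \forall x \near +oo, h1 x = h x / k x.
  near=> x; have E : x * eps (h x) * h1 x = h x by near: x.
  have kx : 0 < k x by near: x.
  by rewrite -[in RHS]E -/(k x) mulrC mulKf ?gt_eqF.
pose k1 x := eps (h x) + x * (eps^`()%classic (h x) * h1 x).
have dk : \forall x \near +oo, is_derive (x : R) 1 k (k1 x).
  near=> x.
  have x0 : 0 < x by near: x; exact/nbhs_pinfty_gt/num_real.
  have hx1 : 1 < h x by near: x.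
  have de : is_derive (h x) 1 eps (eps^`()%classic (h x)).
    by have [? _] := eps2 _ (ltW hx1); rewrite derive1E; exact: derivableP.
  have deh := is_derive1_comp de (dh x0).
  have -> : k = (fun y => y * (eps \o h) y) by [].
  apply: is_derive_eq; rewrite /k1 /GRing.scale/=; ring.
exists (1 + 2); apply: (steep_derivatives_quotient h1E k0 dk).
- have e1h : h x * eps^`()%classic (h x) / eps (h x) @[x --> +oo] --> 0.
    exact: (cvg_comp _ (fun t => t * eps^`()%classic t / eps t) hy e1).
  have e0h : eps (h x) @[x --> +oo] --> 0 by exact: (cvg_comp _ _ hy eps0).
  near=> x.
  have x0 : 0 < x by near: x; exact/nbhs_pinfty_gt/num_real.
  have ex : 0 < eps (h x) by near: x.
  have -> : k1 x = eps (h x) + h x * eps^`()%classic (h x) / eps (h x).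
    have -> : k1 x = eps (h x) + x * (eps^`()%classic (h x) * (h x / k x)).
      by rewrite /k1 (near h1E x).
    by rewrite /k; field; rewrite !gt_eqF.
  rewrite (le_trans (ler_normD _ _))// -[leRHS]/(1 + 1 : R) lerD//; near: x.
    by move/cvgr0Pnorm_le : e0h => /(_ _ ltr01).
  by move/cvgr0Pnorm_le : e1h => /(_ _ ltr01).
- have [T0 [_ HT0]] : \forall t \near +oo, [/\ 1 <= t, 0 < eps t &
      `|t * eps^`()%classic t / eps t| <= 1].
    near=> t; split; near: t => //; first exact/nbhs_pinfty_ge/num_real.
    by move/cvgr0Pnorm_le : e1 => /(_ _ ltr01).
  pose t0 := T0 + 1.
  have Tt0 : T0 < t0 by rewrite ltrDl.
  have dm (t : R) : t0 <= t -> is_derive t 1 (fun t => t * eps t)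
      (eps t + t * eps^`()%classic t).
    move=> /(lt_le_trans Tt0)/HT0[t1 _ _].
    have de : is_derive t 1 eps (eps^`()%classic t).
      by have [? _] := eps2 _ t1; rewrite derive1E; exact: derivableP.
    by apply: is_derive_eq; rewrite /GRing.scale/=; ring.
  have m_ge t : t0 <= t -> t0 * eps t0 <= t * eps t.
    move=> t0t; have [||z] := @MVT_segment _ (fun t => t * eps t)
      (fun t => eps t + t * eps^`()%classic t) t0 t t0t.
    - by move=> y; rewrite in_itv/= => /andP[/ltW + _]; exact: dm.
    - apply: derivable_within_continuous => y; rewrite in_itv/= => /andP[/dm ? _].
      exact: ex_derive.
    rewrite in_itv/= => /andP[t0z _] E.
    rewrite -subr_ge0 E mulr_ge0 ?subr_ge0//.
    have [z1 ez] := HT0 _ (lt_le_trans Tt0 t0z).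
    rewrite ler_norml ler_pdivlMr// => /andP[+ _]; lra.
  have [t01 et0 _] := HT0 _ Tt0.
  have m0 : 0 < t0 * eps t0 by rewrite mulr_gt0// (lt_le_trans ltr01).
  apply/cvgryPge => A; near=> x.
  have x0 : 0 < x by near: x; exact/nbhs_pinfty_gt/num_real.
  have hx : t0 <= h x by near: x; move/cvgryPge : hy; exact.
  have xA : A / (t0 * eps t0) <= x by near: x; exact/nbhs_pinfty_ge/num_real.
  rewrite /k mulrCA.
  apply: (@le_trans _ _ (x * (t0 * eps t0))); first by rewrite -ler_pdivrMr.
  by rewrite ler_wpM2l ?m_ge// ltW.
Unshelve. all: by end_near. Qed.

End cases.
(** * Mean, variance and distribution function of the tilted law *)

Lemma integrable_affine (R : realType) (a s : R) (f : R -> R) : 0 < s ->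
    measurable_fun setT f ->
    lebesgue_measure.-integrable setT (EFin \o (fun u => f (a + s * u))) ->
  lebesgue_measure.-integrable setT (EFin \o f).
Proof.
move=> s0 mf /integrableP[_ intf]; apply/integrableP; split.
  exact/measurable_EFinP.
rewrite (@ge0_integral_affine _ a s) //.
- by rewrite lte_mul_pinfty// lee_fin ltW.
- by apply: measurableT_comp => //; exact/measurable_EFinP.
Qed.

Lemma Rintegral_affine (R : realType) (a s : R) (f : R -> R) : 0 < s ->
    measurable_fun setT f -> lebesgue_measure.-integrable setT (EFin \o f) ->
  \int[lebesgue_measure]_y f y = s * \int[lebesgue_measure]_u f (a + s * u).
Proof.
move=> s0 mf intf.
have mfE : measurable_fun setT (EFin \o f) by exact/measurable_EFinP.
have mpos : measurable_fun setT ((EFin \o f)^\+)%E by exact: measurable_funepos.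
have mneg : measurable_fun setT ((EFin \o f)^\-)%E by exact: measurable_funeneg.
have ip := integrable_fin_num measurableT (integrable_funepos measurableT intf).
have ineg := integrable_fin_num measurableT (integrable_funeneg measurableT intf).
rewrite /Rintegral integralE [in RHS]integralE.
have posE : (\int[lebesgue_measure]_y (EFin \o f)^\+ y = s%:E *
    \int[lebesgue_measure]_u ((fun u => (f (a + s * u))%:E)^\+ u))%E.
  rewrite (ge0_integral_affine a s0 mpos); last by move=> y; exact: funepos_ge0.
  by congr (_ * _)%E; apply: eq_integral => u _; rewrite !funeposE.
have negE : (\int[lebesgue_measure]_y (EFin \o f)^\- y = s%:E *
    \int[lebesgue_measure]_u ((fun u => (f (a + s * u))%:E)^\- u))%E.
  rewrite (ge0_integral_affine a s0 mneg); last by move=> y; exact: funeneg_ge0.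
  by congr (_ * _)%E; apply: eq_integral => u _; rewrite !funenegE.
move: ip ineg.
rewrite posE negE.
have fin (e : \bar R) : (s%:E * e)%E \is a fin_num -> e \is a fin_num.
  case: e => [//||] /=; rewrite ?(gt0_muley, gt0_muleNy) ?lte_fin//.
move=> /fin /fineK pE /fin /fineK nE; rewrite -pE -nE.
by rewrite -!EFinM -!EFinB /= -mulrBr.
Qed.

Section mgf.
Context d (T : measurableType d) (R : realType).
Variables (P : probability T R) (X : {RV P >-> R}) (p : R -> R).
Hypothesis X_density : has_density X p.

Lemma mgfE : mgf X = exp_moment p 0.
Proof.
have [mp p0 pE] := X_density.
apply/funext => t; rewrite /mgf /mmt_gen_fun /exp_moment /Rintegral unlock.
congr fine.
transitivity (\int[P]_w ((fun y => (expR (t * y))%:E) \o X) w)%E.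
  by apply: eq_integral => w _; rewrite /= mulrC.
have mexp : measurable_fun setT (fun y : R => (expR (t * y))%:E).
  apply/measurable_EFinP.
  by apply: measurableT_comp => //; exact: mulrl_measurable.
have exp_ge0 (y : R) : (0 <= (expR (t * y))%:E)%E by rewrite lee_fin expR_ge0.
(* The law of X has to live on the same measurable space as Lebesgue measure,
   whose sigma-algebra is generated by the half-open intervals. *)
pose Xo : T -> measurableTypeR R := X.
have mXo : measurable_fun setT Xo by exact: (measurable_funP X).
pose push := pushforward P Xo : {measure set (measurableTypeR R) -> \bar R}.
have law_density A : measurable A ->
    push mXo A = (\int[lebesgue_measure]_(y in A) (p y)%:E)%E by exact: pE.
transitivity (\int[push mXo]_y (expR (t * y))%:E)%E.
  by rewrite [RHS]ge0_integral_pushforward// => y _; exact: exp_ge0.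
rewrite (@ge0_integral_density _ (measurableTypeR R) _ _ _ _ mp p0
  law_density _ mexp exp_ge0).
by apply: eq_integral => y _; rewrite expr0 mul1r EFinM.
Qed.

Lemma integral_density_le1 : (\int[lebesgue_measure]_y (p y)%:E <= 1)%E.
Proof.
have [_ _ pE] := X_density.
by rewrite -pE// probability_setT.
Qed.

End mgf.

Section log_mgf_derivatives.
Variables (R : realType) (p : R -> R) (T0 : R).
Hypotheses (mp : measurable_fun setT p) (p_ge0 : forall y, 0 <= p y)
  (intp : forall t, T0 < t -> lebesgue_measure.-integrable setT
    (EFin \o (fun y => expR (t * y) * p y)))
  (E0_gt0 : forall t, T0 < t -> 0 < exp_moment p 0 t).

Let E := exp_moment p.

Let dE k t : T0 + 1 < t -> is_derive t 1 (E k) (E k.+1 t).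
Proof.
move=> T0t; apply: (@is_derive_exp_moment _ _ (t - 1) (t + 1)) => //.
- by apply: intp; lra.
- by apply: intp; lra.
- lra.
Qed.

(** The margin of 1 above T0 leaves room for the rates t - 1 and t + 1 in
    [is_derive_exp_moment]. *)
Lemma derive1_ln_mgf t : T0 + 1 < t ->
  (fun u => ln (exp_moment p 0 u))^`()%classic t = E 1%N t / E 0%N t.
Proof.
move=> T0t; have E0 : 0 < E 0%N t by apply: E0_gt0; lra.
have d : is_derive t 1 (@ln R \o E 0%N) ((E 0%N t)^-1 * E 1%N t).
  by apply: is_derive1_comp; [exact: is_derive1_ln|exact: dE].
by rewrite derive1E (@derive_val _ _ _ _ _ _ _ d) mulrC.
Qed.

Lemma derive2_ln_mgf t : T0 + 1 < t ->
  (fun u => ln (exp_moment p 0 u))^`(2)%classic t =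
    E 2%N t / E 0%N t - (E 1%N t / E 0%N t) ^+ 2.
Proof.
move=> T0t; have E0 : 0 < E 0%N t by apply: E0_gt0; lra.
have d1 := dE 1 T0t; have d0 := dE 0 T0t.
have dV : is_derive t 1 (fun u => (E 0%N u)^-1) (- (E 0%N t) ^- 2 *: E 1%N t).
  by apply: is_deriveV; rewrite gt_eqF.
have d : is_derive t 1 (fun u => E 1%N u * (E 0%N u)^-1)
    (E 2%N t / E 0%N t - (E 1%N t / E 0%N t) ^+ 2).
  apply: is_derive_eq; rewrite /GRing.scale/=.
  by field; rewrite gt_eqF.
have d' : is_derive t 1 (fun u => ln (exp_moment p 0 u))^`()%classic
    (E 2%N t / E 0%N t - (E 1%N t / E 0%N t) ^+ 2).
  apply: near_eq_is_derive d; near=> u; rewrite derive1_ln_mgf//.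
  by near: u; exact: lt_nbhsr.
by rewrite /= derive1E (@derive_val _ _ _ _ _ _ _ d').
Unshelve. all: by end_near. Qed.

End log_mgf_derivatives.

(** Suppose that the tilted profiles converge to the normal density under the
    bounds of [laplace_principle]. Then the first two moments of the profile
    converge to those of the normal law, so that the centring x and the scale s
    may be replaced by the mean and the standard deviation of the tilted law. *)
Section standardization.
Context d (T : measurableType d) (R : realType).
Variables (P : probability T R) (X : {RV P >-> R}) (p : R -> R).
Hypothesis X_density : has_density X p.
Variables (x s a : R -> R) (C : R).
Hypotheses (a_gt0 : forall t, 0 < a t) (C_ge0 : 0 <= C)
  (s_gt0 : \forall t \near +oo, 0 < s t)
  (right_gt0 : forall u, \forall t \near +oo, 0 < x t + s t * u)
  (profile_cvg : forall u,
    tilted_profile p t (x t) (s t) (a t) u @[t --> +oo] --> normal_pdf 0 1 u)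
  (profile_le : \forall t \near +oo, forall u, 0 < x t + s t * u ->
    tilted_profile p t (x t) (s t) (a t) u <= C * expR (- (4^-1 * `|u|)))
  (left_cvg0 :
    a t / s t * (1 + (4 + 2 * x t ^+ 2) / s t ^+ 2) @[t --> +oo] --> 0).

Let prof t u := tilted_profile p t (x t) (s t) (a t) u.
Let mp : measurable_fun setT p. Proof. by have [] := X_density. Qed.
Let p_ge0 y : 0 <= p y. Proof. by have [_ ] := X_density. Qed.
Let p1 := integral_density_le1 X_density.
Let a_ge0 t : 0 <= a t. Proof. exact/ltW/a_gt0. Qed.

Let A k t := \int[lebesgue_measure]_u (u ^+ k * prof t u).

Let exprn_le_quadratic k (u : R) : (k <= 2)%N -> `|u ^+ k| <= 1 * (1 + u ^+ 2).
Proof.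
rewrite mul1r normrX -[u ^+ 2]real_normK ?num_real//.
have := normr_ge0 u; move: `|u| => v v0.
case: k => [_|[_|[_|//]]]; rewrite ?expr0 ?expr1; nra.
Qed.

Let moment_cvg k : (k <= 2)%N ->
  A k t @[t --> +oo] --> exp_moment (normal_pdf 0 1) k (0 : R).
Proof.
move=> k2.
have -> : exp_moment (normal_pdf 0 1) k (0 : R) =
    \int[lebesgue_measure]_u (u ^+ k * normal_pdf 0 1 u).
  by apply: eq_Rintegral => u _; rewrite mul0r expR0 mul1r.
apply: (laplace_principle mp p_ge0 p1 a_ge0 C_ge0 s_gt0 right_gt0 profile_cvg profile_le
  left_cvg0 (f := fun _ u => u ^+ k) (D := 1) (z := 0)) => //.
- by apply: nearW => _; exact: measurable_funX.
- by apply: nearW => _ u; exact: exprn_le_quadratic.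
- by move=> u _; exact: cvg_cst.
Qed.

Let A0_cvg : A 0%N t @[t --> +oo] --> (1 : R).
Proof.
have := @moment_cvg 0%N isT.
by rewrite exp_moment_normal0 expr0n/= mul0r expR0.
Qed.

Let A1_cvg : A 1%N t @[t --> +oo] --> (0 : R).
Proof. by have := @moment_cvg 1%N isT; rewrite exp_moment_normal1 mul0r. Qed.

Let A2_cvg : A 2%N t @[t --> +oo] --> (1 : R).
Proof. by have := @moment_cvg 2%N isT; rewrite exp_moment_normal2. Qed.

Let good t := [/\ 0 < s t, 0 < A 0%N t & forall (f : R -> R) D,
  measurable_fun setT f -> (forall u, `|f u| <= D * (1 + u ^+ 2)) ->
  lebesgue_measure.-integrable setT (EFin \o (fun u => f u * prof t u))].

Let good_near : \forall t \near +oo, good t.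
Proof.
near=> t; split.
- by near: t.
- by near: t; exact: (cvgr_gt _ A0_cvg _ ltr01).
- by near: t;
    exact: (laplace_integrable mp p_ge0 p1 a_ge0 C_ge0 s_gt0 profile_le).
Unshelve. all: by end_near. Qed.

Let integrable_moment t k : good t -> (k <= 2)%N ->
  lebesgue_measure.-integrable setT (EFin \o (fun u => u ^+ k * prof t u)).
Proof.
move=> [_ _ it] k2; apply: (it _ 1); first exact: measurable_funX.
by move=> u; exact: exprn_le_quadratic.
Qed.

Let measurable_expp t k :
  measurable_fun setT (fun y : R => y ^+ k * (expR (t * y) * p y)).
Proof.
apply: measurable_funM; first exact: measurable_funX.
by apply: measurable_funM => //; apply: measurableT_comp.
Qed.

Let measurable_exp t : measurable_fun setT (fun y : R => expR (t * y) * p y).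
Proof.
by apply: measurable_funM => //; apply: measurableT_comp.
Qed.

Let integrable_exp t : good t -> lebesgue_measure.-integrable setT
  (EFin \o (fun y => expR (t * y) * p y)).
Proof.
move=> gt; have [st _ _] := gt.
apply: (integrable_affine (a := x t) st); first exact: measurable_exp.
have := integrableZl measurableT (a t)^-1 (@integrable_moment t 0 gt isT).
apply: eq_integrable => // u _; rewrite /= expr0 mul1r /prof /tilted_profile.
by rewrite -EFinM mulKf// gt_eqF.
Qed.

Let exp_moment_affine t k : good t ->
    lebesgue_measure.-integrable setT
      (EFin \o (fun y => y ^+ k * (expR (t * y) * p y))) ->
  exp_moment p k t =
    s t * \int[lebesgue_measure]_u ((a t)^-1 * ((x t + s t * u) ^+ k * prof t u)).
Proof.
move=> [st _ _] it; rewrite /exp_moment.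
rewrite (Rintegral_affine (x t) st (measurable_expp t k) it).
congr (_ * _); apply: eq_Rintegral => u _.
by rewrite /prof /tilted_profile; field; rewrite gt_eqF.
Qed.

Let E0E t : good t -> exp_moment p 0 t = s t / a t * A 0%N t.
Proof.
move=> gt; rewrite exp_moment_affine//; last first.
  have := integrable_exp gt; apply: eq_integrable => // y _.
  by rewrite /= expr0 mul1r.
rewrite RintegralZl//; first by rewrite mulrA.
exact: (integrable_moment (k := 0) gt).
Qed.

(** In the variable u, mean and standard deviation of the tilted law are those
    computed from the moments A k of the profile. *)
Lemma tilted_mean_sd_eq : \forall t \near +oo,
  tilted_mean X t = x t + s t * (A 1%N t / A 0%N t) /\
  tilted_sd X t = s t * Num.sqrt (A 2%N t / A 0%N t - (A 1%N t / A 0%N t) ^+ 2).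
Proof.
have [T0 [_ HT0]] := good_near.
have int_gt t : T0 < t -> lebesgue_measure.-integrable setT
    (EFin \o (fun y => expR (t * y) * p y)).
  by move=> /HT0; exact: integrable_exp.
have E0_gt0 t : T0 < t -> 0 < exp_moment p 0 t.
  move=> /HT0 gt; rewrite E0E//; have [st At _] := gt.
  by rewrite mulr_gt0// divr_gt0.
exists (T0 + 1); split=> [|t T0t]; first exact: num_real.
have gt : good t by apply: HT0; lra.
have [st At it] := gt.
have int_k k : lebesgue_measure.-integrable setT
    (EFin \o (fun y => y ^+ k * (expR (t * y) * p y))).
  apply: (@exp_moment_integrable _ _ (t - 1) (t + 1)) => //.
  - by apply: int_gt; lra.
  - by apply: int_gt; lra.
  - lra.
have i0 := @integrable_moment t 0 gt isT.
have i1 := @integrable_moment t 1 gt isT.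
have i2 := @integrable_moment t 2 gt isT.
have iZ c k : (k <= 2)%N -> lebesgue_measure.-integrable setT
    (EFin \o (fun u => c * (u ^+ k * prof t u))).
  move=> k2; have := integrableZl measurableT c (integrable_moment gt k2).
  exact: eq_integrable.
have E0 := E0E gt.
have E1 : exp_moment p 1 t = s t / a t * (x t * A 0%N t + s t * A 1%N t).
  have i01 : lebesgue_measure.-integrable setT (EFin \o (fun u =>
      x t * (u ^+ 0 * prof t u) + s t * (u ^+ 1 * prof t u))).
    have := integrableD measurableT (iZ (x t) 0%N isT) (iZ (s t) 1%N isT).
    by apply: eq_integrable => // u _; rewrite /= -EFinD.
  rewrite exp_moment_affine// -mulrA; congr (_ * _).
  rewrite -(RintegralZl _ measurableT i0) -(RintegralZl _ measurableT i1).
  rewrite -(RintegralD measurableT (iZ _ 0%N isT) (iZ _ 1%N isT)).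
  rewrite -(RintegralZl _ measurableT i01).
  by apply: eq_Rintegral => u _; ring.
have E2 : exp_moment p 2 t = s t / a t *
    (x t ^+ 2 * A 0%N t + 2 * x t * s t * A 1%N t + s t ^+ 2 * A 2%N t).
  have i01 : lebesgue_measure.-integrable setT (EFin \o (fun u =>
      x t ^+ 2 * (u ^+ 0 * prof t u) + 2 * x t * s t * (u ^+ 1 * prof t u))).
    have := integrableD measurableT (iZ (x t ^+ 2) 0%N isT)
      (iZ (2 * x t * s t) 1%N isT).
    by apply: eq_integrable => // u _; rewrite /= -EFinD.
  have i012 : lebesgue_measure.-integrable setT (EFin \o (fun u =>
      x t ^+ 2 * (u ^+ 0 * prof t u) + 2 * x t * s t * (u ^+ 1 * prof t u) +
      s t ^+ 2 * (u ^+ 2 * prof t u))).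
    have := integrableD measurableT i01 (iZ (s t ^+ 2) 2%N isT).
    by apply: eq_integrable => // u _; rewrite /= -EFinD.
  rewrite exp_moment_affine// -mulrA; congr (_ * _).
  rewrite -(RintegralZl _ measurableT i0) -(RintegralZl _ measurableT i1).
  rewrite -(RintegralZl _ measurableT i2).
  rewrite -(RintegralD measurableT (iZ _ 0%N isT) (iZ _ 1%N isT)).
  rewrite -(RintegralD measurableT i01 (iZ _ 2%N isT)).
  rewrite -(RintegralZl _ measurableT i012).
  by apply: eq_Rintegral => u _; ring.
have an0 : a t != 0 by rewrite gt_eqF.
have sn0 : s t != 0 by rewrite gt_eqF.
have An0 : A 0%N t != 0 by rewrite gt_eqF.
split.
  rewrite /tilted_mean (mgfE X_density).
  rewrite (derive1_ln_mgf mp p_ge0 int_gt E0_gt0 T0t) E0 E1.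
  by field; rewrite an0 sn0 An0.
rewrite /tilted_sd (mgfE X_density).
rewrite (derive2_ln_mgf mp p_ge0 int_gt E0_gt0 T0t) E0 E1 E2.
rewrite -[X in _ = X * _](gtr0_norm st) -sqrtr_sqr -sqrtrM ?sqr_ge0//.
congr Num.sqrt; field.
by rewrite an0 sn0 An0.
Qed.

Let V t := Num.sqrt (A 2%N t / A 0%N t - (A 1%N t / A 0%N t) ^+ 2).

Let A10_cvg : A 1%N t / A 0%N t @[t --> +oo] --> (0 : R).
Proof.
rewrite -[X in _ --> X](mul0r (1^-1 : R)); apply: cvgM => //.
by apply: cvgV => //; rewrite oner_eq0.
Qed.

Let V_cvg : V t @[t --> +oo] --> (1 : R).
Proof.
have h : A 2%N t / A 0%N t - (A 1%N t / A 0%N t) ^+ 2 @[t --> +oo] --> (1 : R).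
  rewrite -[X in _ --> X](_ : 1 * (1^-1 : R) - 0 * 0 = 1); last first.
    by rewrite invr1 mul1r mul0r subr0.
  apply: cvgB.
    by apply: cvgM => //; apply: cvgV => //; rewrite oner_eq0.
  exact: (cvgM A10_cvg A10_cvg).
by rewrite -[X in _ --> X](@sqrtr1 R); exact: (cvg_comp _ _ h (@sqrt_continuous R 1)).
Qed.

(* The threshold z for the standardised variable, in the variable u. *)
Let b (z t : R) := A 1%N t / A 0%N t + V t * z.

Let b_cvg z : b z t @[t --> +oo] --> z.
Proof.
rewrite -[X in _ --> X]add0r -[X in _ --> _ + X]mul1r.
apply: cvgD => //; apply: cvgM => //; exact: cvg_cst.
Qed.

Let cdf_num (z t : R) : R := \int[lebesgue_measure]_u
  (\1_(`]-oo, b z t]%classic : set R) u * prof t u).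

Let cdf_num_cvg z : cdf_num z t @[t --> +oo] -->
  \int[lebesgue_measure]_u (\1_(`]-oo, z]%classic : set R) u * normal_pdf 0 1 u).
Proof.
have m1 (c : R) : measurable_fun setT (\1_(`]-oo, c]%classic : set R) : R -> R).
  by apply: measurable_indic; exact: measurable_itv.
apply: (laplace_principle mp p_ge0 p1 a_ge0 C_ge0 s_gt0 right_gt0 profile_cvg profile_le
  left_cvg0 (f := fun t u => \1_(`]-oo, b z t]%classic : set R) u)
  (D := 1) (z := z)) => //.
- by apply: nearW => t; exact: m1.
- apply: nearW => t u; rewrite mul1r indicE ger0_norm//.
  by case: (u \in _); rewrite ?lerDl ?addr_ge0 ?sqr_ge0.
- move=> u; rewrite neq_lt => /orP[uz|zu]; apply: cvg_near_cst; near=> t.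
    have ut : u <= b z t by near: t; exact: (cvgr_ge _ (@b_cvg z)).
    by rewrite !indicE !mem_set//= in_itv/= ltW.
  have tu : b z t < u by near: t; exact: (cvgr_lt _ (@b_cvg z)).
  by rewrite !indicE !memNset//= in_itv/= leNgt ?zu ?tu.
Unshelve. all: by end_near.
Qed.

Variables (d' : R -> measure_display) (T' : forall t : R, measurableType (d' t)).
Variables (Q : forall t : R, probability (T' t) R)
  (Y : forall t : R, {RV (Q t) >-> R}).
Hypothesis Y_density :
  \forall t \near +oo, has_density (Y t) (tilted_density X p t).

Let cdf_eq z : \forall t \near +oo,
  (cdf_num z t / A 0%N t)%:E =
  cdf (standardized (Y t) (tilted_mean X t) (tilted_sd X t)) z.
Proof.
near=> t.
have gt : good t by near: t.
have [st At it] := gt.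
have [mE sE] : tilted_mean X t = x t + s t * (A 1%N t / A 0%N t) /\
    tilted_sd X t = s t * V t by near: t; exact: tilted_mean_sd_eq.
have Vt : 0 < V t by near: t; exact: (cvgr_gt _ V_cvg _ ltr01).
have sd0 : 0 < tilted_sd X t by rewrite sE mulr_gt0.
have [_ _ YE] : has_density (Y t) (tilted_density X p t) by near: t.
pose c := tilted_mean X t + tilted_sd X t * z.
have cE : c = x t + s t * b z t by rewrite /c mE sE /b; ring.
transitivity (distribution (Q t) (Y t) `]-oo, c]%classic); last first.
  rewrite /cdf /distribution /pushforward; congr (Q t _).
  apply/seteqP; split => w /=; rewrite !in_itv/= ler_pdivrMr//.
    by rewrite lerBlDl (mulrC z).
  by rewrite lerBlDl (mulrC z).
rewrite YE; last exact: measurable_itv.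
pose F (y : R) := (exp_moment p 0 t)^-1 *
  (\1_(`]-oo, c]%classic : set R) y * (expR (t * y) * p y)).
have mF : measurable_fun setT F.
  apply: measurable_funM => //; apply: measurable_funM; last exact: measurable_exp.
  by apply: measurable_indic; exact: measurable_itv.
have Faff u : F (x t + s t * u) = (exp_moment p 0 t)^-1 * (a t)^-1 *
    (\1_(`]-oo, b z t]%classic : set R) u * prof t u).
  rewrite /F /prof /tilted_profile.
  have -> : \1_(`]-oo, c]%classic : set R) (x t + s t * u) =
      \1_(`]-oo, b z t]%classic : set R) u :> R.
    rewrite !indicE; congr (_ : bool)%:R.
    by apply/idP/idP; rewrite !inE/= !in_itv/= cE lerD2l ler_pM2l.
  by field; rewrite !gt_eqF// E0E// mulr_gt0// divr_gt0.
have iu : lebesgue_measure.-integrable setT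
    (EFin \o (fun u => \1_(`]-oo, b z t]%classic : set R) u * prof t u)).
  apply: (it _ 1).
    by apply: measurable_indic; exact: measurable_itv.
  move=> u; rewrite mul1r indicE ger0_norm//.
  by case: (u \in _); rewrite ?lerDl ?addr_ge0 ?sqr_ge0.
have iF : lebesgue_measure.-integrable setT (EFin \o F).
  apply: (integrable_affine (a := x t) st mF).
  have := integrableZl measurableT ((exp_moment p 0 t)^-1 * (a t)^-1) iu.
  by apply: eq_integrable => // u _; rewrite /= Faff.
transitivity (\int[lebesgue_measure]_y (F y)%:E)%E; last first.
  rewrite [RHS]integral_mkcond; apply: eq_integral => y _.
  rewrite patchE /F /tilted_density indicE (mgfE X_density).
  by case: ifPn => yc; [rewrite mul1r; congr EFin; ring|rewrite mul0r mulr0].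
rewrite -[RHS]fineK; last exact: integrable_fin_num.
congr EFin; rewrite -/(Rintegral _ _ _).
rewrite [RHS](Rintegral_affine (x t) st mF iF).
under eq_Rintegral do rewrite Faff.
rewrite RintegralZl// -/(cdf_num z t) E0E//.
by field; rewrite !gt_eqF.
Unshelve. all: by end_near. Qed.

Theorem standardized_cvg_normal : cvg_in_distribution +oo
  (fun t : R => standardized (Y t) (tilted_mean X t) (tilted_sd X t))
  (normal_prob 0 1).
Proof.
move=> z _.
have lim : cdf_num z t / A 0%N t @[t --> +oo] -->
    \int[lebesgue_measure]_u (\1_(`]-oo, z]%classic : set R) u * normal_pdf 0 1 u).
  have A0V : (A 0%N t)^-1 @[t --> +oo] --> (1^-1 : R).
    by apply: cvgV => //; rewrite oner_eq0.
  have := cvgM (@cdf_num_cvg z) A0V; rewrite invr1 mulr1; exact.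
have normalE : normal_prob 0 1 `]-oo, z]%classic =
    (\int[lebesgue_measure]_u
      (\1_(`]-oo, z]%classic : set R) u * normal_pdf 0 1 u))%:E.
  have iN : lebesgue_measure.-integrable setT (EFin \o (fun u : R =>
      \1_(`]-oo, z]%classic : set R) u * normal_pdf 0 1 u)).
    apply: (le_integrable measurableT _ _ (integrable_normal_pdf 0 1)).
      apply/measurable_EFinP; apply: measurable_funM.
        by apply: measurable_indic; exact: measurable_itv.
      exact: measurable_normal_pdf.
    move=> u _; rewrite /= lee_fin normrM ler_piMl// indicE.
    by case: (u \in _); rewrite ?normr1 ?normr0.
  rewrite /Rintegral fineK; last exact: integrable_fin_num.
  rewrite /normal_prob [LHS]integral_mkcond; apply: eq_integral => u _.
  by rewrite patchE indicE; case: ifPn => _; rewrite ?mul1r ?mul0r.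
have : cdf (standardized (Y t) (tilted_mean X t) (tilted_sd X t)) z
    @[t --> +oo] --> normal_prob 0 1 `]-oo, z]%classic.
  rewrite normalE; apply: cvg_trans (near_eq_cvg (@cdf_eq z)) _.
  by apply: cvg_EFin; [exact: nearW|exact: lim].
exact.
Qed.

End standardization.

(** * The tilted law *)

Section density_form.
Variables (R : realType) (p g q : R -> R).
Hypothesis p_form : density_form p g q.

Lemma g_is_derive (k : nat) (x : R) : (k < 4)%N -> 0 < x ->
  is_derive x 1 (g^`(k))%classic ((g^`(k.+1))%classic x).
Proof.
move=> k4 x0; rewrite /= derive1E; apply: derivableP.
by have [_ _ _ dg _ _ _ _ _] := p_form; exact: dg.
Qed.

Lemma q_norm_bounded : exists B, forall x, 0 <= x -> `|q x| <= B.
Proof.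
have [_ _ _ _ _ _ _ _ [M [_ HM]]] := p_form.
exists (M + 1) => x x0; apply: (HM (M + 1)); first by rewrite ltrDl.
by rewrite /= in_itv/= andbT.
Qed.

End density_form.


Section tilted_profile_limit.
Variables (R : realType) (p g q h h1 h2 psi : R -> R) (B C : R).
Hypotheses (pE : forall x : R, 0 <= x -> p x = expR (- (g x - q x)))
  (dg : forall x : R, 0 < x -> is_derive x 1 g (h x))
  (dh : forall x : R, 0 < x -> is_derive x 1 h (h1 x))
  (dh1 : forall x : R, 0 < x -> is_derive x 1 h1 (h2 x))
  (h_mono : forall x y : R, 0 < x -> x <= y -> h x <= h y)
  (hy : h x @[x --> +oo] --> +oo)
  (h_steep : steep_derivatives h h1 h2 C)
  (qB : forall x, 0 <= x -> `|q x| <= B)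
  (q_cvg0 : q x @[x --> +oo] --> 0)
  (psiy : psi t @[t --> +oo] --> +oo)
  (hpsi : \forall t \near +oo, h (psi t) = t).

Let S x := spread h1 x.
Let peak : R := normal_peak 1.
Let amp x := peak * expR (- (h x * x - g x)).

Let peak_gt0 : 0 < peak. Proof. by rewrite normal_peak_gt0// oner_eq0. Qed.

(** The amplitude cancels the peak value of e^(t y - g y), and t = h x is the
    slope at x, so that what remains in the exponent is the gap between g and its
    tangent. *)
Lemma tilted_profileE x u : 0 < x + S x * u ->
  tilted_profile p (h x) x (S x) (amp x) u =
  peak * expR (- bregman g h h1 x u) * expR (q (x + S x * u)).
Proof.
move=> y0; rewrite /tilted_profile pE ?(ltW y0)// /amp -!mulrA -!expRD.
by congr (_ * expR _); rewrite /bregman -/(S x); ring.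
Qed.

Let far A V : \forall x \near +oo, forall v, `|v| <= V -> A <= x + S x * v.
Proof. exact: (spread_far dh1 hy h_steep). Qed.

Let right_gt0 u : \forall x \near +oo, 0 < x + S x * u.
Proof.
apply: filterS (@far 1 `|u|) => x /(_ u (lexx _)); exact: lt_le_trans.
Qed.

Let tilted_profile_cvg u : tilted_profile p (h x) x (S x) (amp x) u
  @[x --> +oo] --> normal_pdf 0 1 u.
Proof.
have -> : normal_pdf 0 1 u = peak * expR (- (u ^+ 2 / 2)) * expR 0.
  rewrite normal_pdfE ?oner_eq0// expR0 mulr1 /normal_fun subr0 expr1n.
  by rewrite -mulr_natl mulr1 mulNr.
have brg : bregman g h h1 x u @[x --> +oo] --> u ^+ 2 / 2.
  exact: (bregman_cvg dg dh dh1 hy h_steep).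
have expr_cont (f : R -> R) (l : R) : f x @[x --> +oo] --> l ->
    expR (f x) @[x --> +oo] --> expR l.
  by move=> fl; exact: (cvg_comp _ _ fl (@continuous_expR R l)).
have shift_y : x + S x * u @[x --> +oo] --> +oo.
  apply/cvgryPge => A; apply: filterS (@far A `|u|) => x /(_ u (lexx _)); exact.
have qy : q (x + S x * u) @[x --> +oo] --> 0 by exact: (cvg_comp _ _ shift_y q_cvg0).
have lim : peak * expR (- bregman g h h1 x u) * expR (q (x + S x * u))
    @[x --> +oo] --> peak * expR (- (u ^+ 2 / 2)) * expR 0.
  apply: cvgM; last exact: expr_cont.
  by apply: cvgM; [exact: cvg_cst|apply: expr_cont; exact: cvgN].
apply: cvg_trans lim; apply: near_eq_cvg; near=> x.
rewrite tilted_profileE//; near: x; exact: right_gt0.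
Unshelve. all: by end_near. Qed.

Let tilted_profile_le : \forall x \near +oo, forall u, 0 < x + S x * u ->
  tilted_profile p (h x) x (S x) (amp x) u <=
    peak * expR (4^-1 + B) * expR (- (4^-1 * `|u|)).
Proof.
near=> x => u y0; rewrite tilted_profileE// -!mulrA -!expRD.
rewrite ler_wpM2l ?(ltW peak_gt0)// ler_expR.
have := qB (ltW y0); rewrite ler_norml => /andP[_ qyB].
have : (`|u| - 1) / 4 <= bregman g h h1 x u.
  by move: u y0 {qyB}; near: x; exact: (bregman_ge dg dh dh1 h_mono hy h_steep).
lra.
Unshelve. all: by end_near. Qed.

Let left_tail x : amp x / S x * (1 + (4 + 2 * x ^+ 2) / S x ^+ 2) =
  peak * (expR (- (h x * x - g x)) / S x * (1 + (4 + 2 * x ^+ 2) / S x ^+ 2)).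
Proof. by rewrite /amp !mulrA. Qed.

Let left_cvg0 :
  amp x / S x * (1 + (4 + 2 * x ^+ 2) / S x ^+ 2) @[x --> +oo] --> 0.
Proof.
have lim : peak * (expR (- (h x * x - g x)) / S x *
    (1 + (4 + 2 * x ^+ 2) / S x ^+ 2)) @[x --> +oo] --> peak * 0.
  apply: cvgM; first exact: cvg_cst.
  exact: (left_tail_cvg0 dg dh dh1 h_mono hy h_steep).
move: lim; rewrite mulr0; apply: cvg_trans; apply: near_eq_cvg.
by apply: nearW => x; rewrite left_tail.
Qed.

Let near_psi (A : R -> Prop) : (\forall x \near +oo, A x) ->
  \forall t \near +oo, A (psi t) /\ h (psi t) = t.
Proof.
move=> HA; have HA' : \forall t \near +oo, A (psi t) by exact: psiy.
by near=> t; split; near: t.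
Unshelve. all: by end_near. Qed.

Variables (d : measure_display) (T : measurableType d) (P : probability T R).
Variables (X : {RV P >-> R}).
Hypothesis X_density : has_density X p.
Variables (d' : R -> measure_display) (T' : forall t : R, measurableType (d' t)).
Variables (Q : forall t : R, probability (T' t) R)
  (Y : forall t : R, {RV (Q t) >-> R}).
Hypothesis Y_density :
  \forall t \near +oo, has_density (Y t) (tilted_density X p t).

(** The peak x is psi t, so limits in x become limits in t along psi. *)
Theorem steep_tilted_cvg_normal : cvg_in_distribution +oo
  (fun t : R => standardized (Y t) (tilted_mean X t) (tilted_sd X t))
  (normal_prob 0 1).
Proof.
apply: (@standardized_cvg_normal _ _ _ _ _ _ X_density psi (S \o psi)
  (amp \o psi) (peak * expR (4^-1 + B))) => //.
- by move=> t; rewrite mulr_gt0// expR_gt0.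
- by rewrite mulr_ge0 ?expR_ge0// ltW.
- by apply: nearW => t; exact: spread_gt0.
- by move=> u; apply: filterS (near_psi (@right_gt0 u)) => t [].
- move=> u; have lim := cvg_comp _ _ psiy (@tilted_profile_cvg u).
  apply: cvg_trans lim; apply: near_eq_cvg.
  by apply: filterS hpsi => t /= ->.
- by apply: filterS (near_psi tilted_profile_le) => t [+ ht] u; rewrite ht; exact.
- exact: (cvg_comp _ _ psiy left_cvg0).
Qed.

End tilted_profile_limit.

Theorem theorem3 (R : realType) (d : measure_display) (T : measurableType d)
    (P : probability T R) (X : {RV P >-> R}) (p g q psi : R -> R)
    (X_density : has_density X p)
    (X_support : full_support X)
    (X_mgf : \forall t \near (0 : R), ('M_P X t < +oo)%E)
    (p_form : density_form p g q)
    (psi_inverse : inverse_at_infty g^`() psi)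
    (h_q_cases :
      (exists beta theta eta : R,
        [/\ regularly_varying_case g^`() beta theta,
            regularly_varying (fun x => `|q x|) eta &
            eta < theta - 3 * beta / 2 - 3 / 2]) \/
      (exists eta : R,
        [/\ rapidly_varying_case psi,
            regularly_varying (fun t => `|q (psi t)|) eta &
            eta < - (1 / 2)]))
    (d' : R -> measure_display) (T' : forall t : R, measurableType (d' t))
    (Q : forall t : R, probability (T' t) R)
    (Y : forall t : R, {RV (Q t) >-> R})
    (Y_density : \forall t \near +oo, has_density (Y t) (tilted_density X p t)) :
  cvg_in_distribution +oo
    (fun t : R => standardized (Y t) (tilted_mean X t) (tilted_sd X t))
    (normal_prob 0 1).
Proof.
pose h : R -> R := g^`()%classic.
have dg (x : R) : 0 < x -> is_derive x 1 g (h x) by exact: (g_is_derive p_form (k := 0)).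
have dh (x : R) : 0 < x -> is_derive x 1 h (h^`()%classic x).
  exact: (g_is_derive p_form (k := 1)).
have dh1 (x : R) : 0 < x -> is_derive x 1 h^`()%classic (h^`(2)%classic x).
  exact: (g_is_derive p_form (k := 2)).
have [pE _ _ _ _ h_gt0 h_mono hy _] := p_form.
have [B qB] := q_norm_bounded p_form.
have [hpsi psih psiy] := psi_inverse.
have [[C h_steep] q_cvg0] : (exists C, steep_derivatives h h^`()%classic h^`(2)%classic C) /\
    (q x @[x --> +oo] --> 0).
  case: h_q_cases => [[beta [theta [eta [rv rq eta_lt]]]]|[eta [rv rq eta_lt]]].
    split; first exact: (regularly_varying_steep dh dh1 h_gt0 hy rv).
    have [beta0 _ theta_le _] := rv.
    apply/norm_cvg0P.
    apply: (@regularly_varying_cvg0 _ (fun x => `|q x|) eta 0 B) => //.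
    lra.
  split; first exact: (rapidly_varying_steep dh dh1 h_gt0 h_mono hy psi_inverse rv).
  have [A [_ HA]] : \forall t \near +oo, 0 <= psi t by move/cvgryPge : psiy; exact.
  have qpsi : `|q (psi t)| @[t --> +oo] --> (0 : R).
    apply: (@regularly_varying_cvg0 _ _ eta (A + 1) B) => //.
      by move=> t At; apply/qB/HA; rewrite (lt_le_trans _ At)// ltrDl.
    lra.
  apply/norm_cvg0P; apply: cvg_trans (cvg_comp _ _ hy qpsi).
  by apply: near_eq_cvg; apply: filterS psih => x /= ->.
exact: (steep_tilted_cvg_normal pE dg dh dh1 h_mono hy h_steep qB q_cvg0 psiy hpsi
  X_density Y_density).
Qed.
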